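(* Let $\sigma>0$, $a\in(0,\infty)^d$, and let $\{\xi_k\}_{k\in\mathbb{Z}}$ be an $a$-separated sequence of vectors in $\mathbb{R}^d$. Then for every finite sequence of complex numbers $\{w_{-N},\dots,w_0,\dots,w_N\}$ we have $$-A(a,d,\sigma)\sum_{n=-N}^N|w_n|^2\ \le\ \sum_{\substack{n,m=-N\\ n\ne m}}^N\frac{w_n\overline{w_m}}{|\xi_n-\xi_m|^{d+\sigma}}\ \le\ B(a,d,\sigma)\sum_{n=-N}^N|w_n|^2,$$ where $$A(a,d,\sigma)=-\sum_{j=1}^d\ \sum_{n\in\mathbb{Z}^d\setminus\{0\}}\frac{(-1)^{n_j}}{|an|^{d+\sigma}}+(d-1)\sum_{n\in\mathbb{Z}^d\setminus\{0\}}\frac{1}{|an|^{d+\sigma}}$$ and $$B(a,d,\sigma)=\sum_{n\in\mathbb{Z}^d\setminus\{0\}}\frac{1}{|an|^{d+\sigma}}.$$ Furthermore, the constant $B(a,d,\sigma)$ is sharp: it cannot be replaced by a smaller constant for which the right-hand inequality holds for all $a$-separated sequences and all finite sequences of complex numbers.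
   Context: $|\cdot|$ is the Euclidean norm on $\mathbb{R}^d$; $an=(a_1n_1,\dots,a_dn_d)$. For $a\in(0,\infty)^d$ and $x\in\mathbb{R}^d$, $|x|_a=\max\{|x_j/a_j|:1\le j\le d\}$; a sequence $\{\xi_k\}_{k\in\mathbb{Z}}$ in $\mathbb{R}^d$ is $a$-separated if $|\xi_k-\xi_l|_a\ge1$ for all $k\ne l$. *)

(* Defs.v *)
From mathcomp Require Import all_boot all_order all_algebra.
From mathcomp Require Import all_classical all_reals all_analysis.
From mathcomp Require Import complex.

Set Implicit Arguments.
Unset Strict Implicit.
Unset Printing Implicit Defensive.

Import Order.TTheory GRing.Theory Num.Theory.

Local Open Scope classical_set_scope.
Local Open Scope ring_scope.

Section Euclidean.
Context {R : realType} {d : nat}.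
Implicit Types (a x : 'rV[R]_d) (n : 'rV[int]_d).

(* The library norm `|x| on 'rV[R]_d is the max norm, hence this definition. *)
Definition enorm x : R := Num.sqrt (\sum_(j < d) x 0 j ^+ 2).

Definition anorm a x : R := \big[Num.max/0]_(j < d) `|x 0 j / a 0 j|.

Definition a_separated a (xi : int -> 'rV[R]_d) : Prop :=
  forall k l : int, k <> l -> 1 <= anorm a (xi k - xi l).

Definition dilate a n : 'rV[R]_d := \row_j (a 0 j * (n 0 j)%:~R).

(* Unordered sum over Z^d \ {0} of a real family, as the difference of the sums
   of its positive and negative parts. This is the usual value whenever the
   family is absolutely summable, as it is for the families used below when
   sigma > 0 and all a 0 j > 0. *)
Definition latsum (f : 'rV[int]_d -> R) : R :=
  fine (\esum_(n in [set n : 'rV[int]_d | n != 0%R]) ((EFin \o f)^\+ n)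
      - \esum_(n in [set n : 'rV[int]_d | n != 0%R]) ((EFin \o f)^\- n))%E.

Definition constB a (sigma : R) : R :=
  latsum (fun n => 1 / enorm (dilate a n) `^ (d%:R + sigma)).

Definition constA a (sigma : R) : R :=
  - (\sum_(j < d)
       latsum (fun n => (-1) ^ (n 0 j) / enorm (dilate a n) `^ (d%:R + sigma)))
  + (d%:R - 1) * latsum (fun n => 1 / enorm (dilate a n) `^ (d%:R + sigma)).

End Euclidean.

(* The integers -N, ..., N. *)
Definition symrange (N : nat) : seq int :=
  [seq i%:Z - N%:Z | i <- iota 0 N.*2.+1].

Section Forms.
Context {R : realType} {d : nat}.
Local Open Scope complex_scope.

Definition hform (sigma : R) (xi : int -> 'rV[R]_d) (N : nat)
    (w : int -> R[i]) : R[i] :=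
  \sum_(n <- symrange N) \sum_(m <- symrange N | n != m)
    w n * (w m)^* / (enorm (xi n - xi m) `^ (d%:R + sigma))%:C.

Definition l2sq (N : nat) (w : int -> R[i]) : R[i] :=
  \sum_(n <- symrange N) `|w n| ^+ 2.

End Forms.

(* Main.v *)
Require Import Defs.
From mathcomp Require Import all_boot all_order all_algebra.
From mathcomp Require Import all_classical all_reals all_analysis.
From mathcomp Require Import complex.
From mathcomp Require Import measurable_realfun.
From mathcomp Require Import zify ring lra.

(** Gaussian subordination: |x|^(-d-sigma) is a mixture of the Gaussians
   exp(-mu |x|^2), so it suffices to prove, for each mu, the inequality with
   lattice sums of the Gaussian as constants, and to integrate over mu.

   For one variable put g(t) = exp(-mu t^2), e = 1 or -1, and
     phi(t) = sum_(k >= 1) (-e)^(k-1) k g(a k + |t|),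
     H(t) = 2 phi(t) + e (phi(t + a) + phi(t - a)).
   The sum telescopes: H(t) = e g(t) for |t| >= a, while H(0) is, up to sign,
   the sum over k != 0 of g(a k) (e = -1) or of (-1)^k g(a k) (e = 1). Hence g + H
   for e = -1 and g - H for e = 1 vanish outside ]-a, a[; their Fourier transforms
   are the extremal majorant and minorant of a Gaussian. Everything rests on H being
   positive definite, which follows from phi being so.
   Since g(a k + |t|) = g(a k) exp(-2 mu a k |t|) g(t), this is clear for e = -1.
   For e = 1, writing exp(-c |t|) as a mixture of Gaussians reduces it to
   sum_(k >= 1) (-1)^(k-1) k^2 exp(-nu k^2) >= 0, that is, to the monotonicity of
   theta(q) = sum_k (-1)^k q^(k^2) = prod_k (1 - q^k) / (1 + q^k).

   In d variables, with M_j = g_j + F_j and L_j = g_j - E_j built from these kernels,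
   prod M_j - prod g_j and prod g_j - (sum_j L_j prod_(i <> j) M_i - (d-1) prod M_j)
   are positive definite, equal to -+ the Gaussian at a-separated arguments, and their
   values at 0 are the Gaussian versions of B and A.

   Sharpness: take the points of a large box of the lattice and constant weights. *)

Import Order.TTheory GRing.Theory Num.Theory.
Import numFieldNormedType.Exports.

Local Open Scope ring_scope.

Set Implicit Arguments.
Unset Strict Implicit.
Unset Printing Implicit Defensive.

(** * Limits of finite sums *)

Section Preliminaries.
Context {R : realType}.
Local Open Scope classical_set_scope.

Lemma cvgr_sum (T : Type) (F : set_system T) (FF : Filter F) (I : Type)
    (s : seq I) (f : T -> I -> R) (l : I -> R) :
  (forall i, f x i @[x --> F] --> l i) ->
  \sum_(i <- s) f x i @[x --> F] --> \sum_(i <- s) l i.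
Proof.
move=> fl; elim: s => [|i s IH].
  rewrite big_nil; under eq_fun do rewrite big_nil; exact: cvg_cst.
rewrite big_cons; under eq_fun do rewrite big_cons; apply: cvgD => //; exact: fl.
Qed.

End Preliminaries.

(** * Positive semidefinite kernels and positive definite functions *)

Section SchurMultipliers.
Context {R : realType}.

Definition qform (T : Type) (l : T -> T -> R) (s : seq (R * T)) : R :=
  \sum_(x <- s) \sum_(y <- s) x.1 * y.1 * l x.2 y.2.

Definition psd (T : Type) (l : T -> T -> R) : Prop := forall s, 0 <= qform l s.

(* Kernels whose pointwise product with any positive semidefinite kernel is
   positive semidefinite. They are closed under products by definition, so the
   Schur product theorem is not needed. *)
Definition schur (T : Type) (k : T -> T -> R) : Prop :=
  forall l, psd l -> psd (fun x y => k x y * l x y).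

(* Difference kernels phi (s - t) pulled back along an arbitrary p; points may
   therefore be repeated or translated freely. *)
Definition pdf (phi : R -> R) : Prop :=
  forall (T : Type) (p : T -> R), schur (fun x y => phi (p x - p y)).

Lemma qformD (T : Type) (k l : T -> T -> R) s :
  qform (fun x y => k x y + l x y) s = qform k s + qform l s.
Proof.
rewrite /qform -big_split; apply: eq_bigr => x _.
by rewrite -big_split; apply: eq_bigr => y _; rewrite mulrDr.
Qed.

Lemma qformZ (T : Type) (l : T -> T -> R) c s :
  qform (fun x y => c * l x y) s = c * qform l s.
Proof.
rewrite /qform mulr_sumr; apply: eq_bigr => x _.
by rewrite mulr_sumr; apply: eq_bigr => y _; rewrite mulrCA.
Qed.

Lemma eq_qform (T : Type) (k l : T -> T -> R) s :
  k =2 l -> qform k s = qform l s.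
Proof. by move=> kl; apply: eq_bigr => x _; apply: eq_bigr => y _; rewrite kl. Qed.

Lemma eq_psd (T : Type) (k l : T -> T -> R) : k =2 l -> psd k -> psd l.
Proof. by move=> kl k0 s; rewrite -(eq_qform s kl). Qed.

Lemma eq_schur (T : Type) (k l : T -> T -> R) : k =2 l -> schur k -> schur l.
Proof. by move=> kl sk m m0; apply: eq_psd (sk _ m0) => x y; rewrite kl. Qed.

Lemma eq_pdf (f g : R -> R) : f =1 g -> pdf f -> pdf g.
Proof. by move=> fg pf T p; apply: eq_schur (pf T p) => x y; rewrite fg. Qed.

Lemma qform_map (T U : Type) (p : T -> U) (l : U -> U -> R) s :
  qform l [seq (x.1, p x.2) | x <- s] = qform (fun x y => l (p x) (p y)) s.
Proof. by rewrite /qform big_map; apply: eq_bigr => x _; rewrite big_map. Qed.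

Lemma psd_comp (T U : Type) (p : T -> U) (l : U -> U -> R) :
  psd l -> psd (fun x y => l (p x) (p y)).
Proof. by move=> l0 s; rewrite -qform_map. Qed.

Lemma qform_cat (T : Type) (l : T -> T -> R) s1 s2 :
  qform l (s1 ++ s2) = qform l s1 + qform l s2
    + (\sum_(x <- s1) \sum_(y <- s2) x.1 * y.1 * l x.2 y.2
       + \sum_(x <- s2) \sum_(y <- s1) x.1 * y.1 * l x.2 y.2).
Proof.
rewrite /qform big_cat /=.
under eq_bigr do rewrite big_cat /=.
under [X in _ + X = _]eq_bigr do rewrite big_cat /=.
by rewrite !big_split /=; ring.
Qed.

(** Test the multiplier on the constant kernel 1, whose form is the square of the total weight. *)
Lemma schur_psd (T : Type) (k : T -> T -> R) : schur k -> psd k.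
Proof.
move=> sk; have : psd (fun _ _ : T => 1 : R).
  move=> s; rewrite /qform.
  have -> : \sum_(x <- s) \sum_(y <- s) x.1 * y.1 * 1 = (\sum_(x <- s) x.1) ^+ 2.
    rewrite expr2 mulr_suml; apply: eq_bigr => x _.
    by rewrite mulr_sumr; apply: eq_bigr => y _; rewrite mulr1.
  exact: sqr_ge0.
by move/sk; apply: eq_psd => x y; rewrite mulr1.
Qed.

Lemma schurD (T : Type) (k l : T -> T -> R) :
  schur k -> schur l -> schur (fun x y => k x y + l x y).
Proof.
move=> sk sl m m0 s; under eq_qform do rewrite mulrDl.
by rewrite qformD addr_ge0 ?sk ?sl.
Qed.

Lemma schurZ (T : Type) (k : T -> T -> R) c :
  0 <= c -> schur k -> schur (fun x y => c * k x y).
Proof.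
move=> c0 sk m m0 s; under eq_qform do rewrite -mulrA.
by rewrite qformZ mulr_ge0 ?sk.
Qed.

Lemma schurM (T : Type) (k l : T -> T -> R) :
  schur k -> schur l -> schur (fun x y => k x y * l x y).
Proof.
by move=> sk sl m m0; apply: eq_psd (sk _ (sl _ m0)) => x y; rewrite mulrA.
Qed.

(** The values of [f] are absorbed into the weights. *)
Lemma schur_rank1 (T : Type) (f : T -> R) : schur (fun x y => f x * f y).
Proof.
move=> l l0 s; have := l0 [seq (x.1 * f x.2, x.2) | x <- s].
rewrite /qform big_map; under eq_bigr do rewrite big_map /=.
congr (_ <= _); apply: eq_bigr => x _; apply: eq_bigr => y _.
by ring.
Qed.

Lemma schur1 (T : Type) : schur (fun _ _ : T => 1).
Proof. by apply: eq_schur (schur_rank1 (fun=> 1)) => x y; rewrite mulr1. Qed.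

Lemma schurX (T : Type) (k : T -> T -> R) n :
  schur k -> schur (fun x y => k x y ^+ n).
Proof.
move=> sk; elim: n => [|n IH].
  by apply: eq_schur (@schur1 T) => x y; rewrite expr0.
by apply: eq_schur (schurM sk IH) => x y; rewrite exprS.
Qed.

Lemma schur_sum (T : Type) (k : nat -> T -> T -> R) n :
  (forall i, schur (k i)) -> schur (fun x y => \sum_(0 <= i < n) k i x y).
Proof.
move=> sk; elim: n => [|n IH].
  apply: eq_schur (schurZ (lexx 0) (@schur1 T)) => x y.
  by rewrite mul0r big_nil.
by apply: eq_schur (schurD IH (sk n)) => x y; rewrite big_nat_recr.
Qed.

Local Open Scope classical_set_scope.

Lemma schur_cvg (T : Type) (k : nat -> T -> T -> R) (l : T -> T -> R) :
  (forall n, schur (k n)) -> (forall x y, k n x y @[n --> \oo] --> l x y) ->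
  schur l.
Proof.
move=> sk kl m m0 s.
have cv : qform (fun x y => k n x y * m x y) s @[n --> \oo]
    --> qform (fun x y => l x y * m x y) s.
  apply: cvgr_sum => x; apply: cvgr_sum => y.
  by apply: cvgMl_tmp; apply: cvgMr_tmp; exact: kl.
by apply: (cvgr_to_ge cv); apply: nearW => n; exact: sk.
Qed.

(** The exponential series has nonnegative coefficients, and multipliers are closed under powers,
    nonnegative combinations and pointwise limits. *)
Lemma schur_expR (T : Type) (k : T -> T -> R) :
  schur k -> schur (fun x y => expR (k x y)).
Proof.
move=> sk.
pose e n x y := \sum_(0 <= i < n) (i`!%:R)^-1 * k x y ^+ i.
apply: (@schur_cvg _ e) => [n|x y].
  by apply: schur_sum => i; apply: schurZ; [rewrite invr_ge0|exact: schurX].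
have := is_cvg_series_exp_coeff (k x y); rewrite exp_coeffE => cv.
by rewrite expRE; exact: cv.
Qed.

Lemma pdfM (f g : R -> R) : pdf f -> pdf g -> pdf (fun t => f t * g t).
Proof. by move=> pf pg T p; exact: schurM. Qed.

Lemma pdfZ c (f : R -> R) : 0 <= c -> pdf f -> pdf (fun t => c * f t).
Proof. by move=> c0 pf T p; exact: schurZ. Qed.

Lemma pdf_sum (f : nat -> R -> R) n :
  (forall i, pdf (f i)) -> pdf (fun t => \sum_(0 <= i < n) f i t).
Proof. by move=> pf T p; apply: schur_sum => i; exact: pf. Qed.

Lemma pdf_cvg (f : nat -> R -> R) (g : R -> R) :
  (forall n, pdf (f n)) -> (forall t, f n t @[n --> \oo] --> g t) -> pdf g.
Proof.
move=> pf fg T p; apply: (@schur_cvg _ (fun n x y => f n (p x - p y))) => //.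
by move=> n; exact: pf.
Qed.

(** Expanding the square, exp(-mu (x - y)^2) is the rank one kernel exp(-mu x^2) exp(-mu y^2) times
    the exponential of the kernel 2 mu x y. *)
Lemma pdf_gauss mu : 0 <= mu -> pdf (fun t => expR (- (mu * t ^+ 2))).
Proof.
move=> mu0 T p.
have r1 := schur_rank1 (fun x : T => expR (- (mu * p x ^+ 2))).
have re : schur (fun x y : T => expR (2 * mu * (p x * p y))).
  by apply: schur_expR; apply: schurZ; [rewrite mulr_ge0|exact: schur_rank1].
apply: eq_schur (schurM r1 re) => x y.
by rewrite -!expRD; congr expR; ring.
Qed.

(* Attach to each point x its translate by a, with weight multiplied by e. *)
Lemma pdf_second_difference (f : R -> R) a e : e ^+ 2 = 1 -> pdf f ->
  pdf (fun t => 2 * f t + e * (f (t + a) + f (t - a))).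
Proof.
move=> e1 pf T p l l0 s.
pose q (u : T * bool) := p u.1 + (if u.2 then a else 0).
have l1 : psd (fun u v : T * bool => l u.1 v.1) by exact: (psd_comp _ l0).
pose s1 := [seq (x.1, (x.2, false)) | x <- s].
pose s2 := [seq (e * x.1, (x.2, true)) | x <- s].
have := pf _ q _ l1 (s1 ++ s2).
rewrite qform_cat /s1 /s2 /qform !big_map.
under eq_bigr do rewrite big_map.
under [X in _ + X + _]eq_bigr do rewrite big_map.
under [X in _ + (X + _)]eq_bigr do rewrite big_map.
under [X in _ + (_ + X)]eq_bigr do rewrite big_map.
rewrite -!big_split /=; congr (_ <= _); apply: eq_bigr => x _.
rewrite -!big_split /=; apply: eq_bigr => y _.
rewrite /q /= !addr0.
have -> : p x.2 + a - (p y.2 + a) = p x.2 - p y.2 by ring.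
have -> : p x.2 + a - p y.2 = p x.2 - p y.2 + a by ring.
have -> : p x.2 - (p y.2 + a) = p x.2 - p y.2 - a by ring.
set A := f _; set B := f _; set C := f _.
have -> : e * x.1 * (e * y.1) = x.1 * y.1 by rewrite mulrACA -expr2 e1 mul1r.
by ring.
Qed.

End SchurMultipliers.

(** * Calculus on the half-line and the error function *)

Section GaussianMixtures.
Context {R : realType}.
Local Open Scope classical_set_scope.

Lemma is_derive_bigsum (I : Type) (s : seq I) (f : I -> R -> R) (df : I -> R) (x : R) :
  (forall i, is_derive x 1 (f i) (df i)) ->
  is_derive x 1 (fun y => \sum_(i <- s) f i y) (\sum_(i <- s) df i).
Proof.
move=> fdf; elim: s => [|i s IH].
  rewrite big_nil; under eq_fun do rewrite big_nil; exact: is_derive_cst.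
rewrite big_cons; under eq_fun do rewrite big_cons; exact: is_deriveD.
Qed.

Lemma gt0_is_derive_le (f df : R -> R) :
  (forall x : R, 0 < x -> is_derive x 1 f (df x)) ->
  (forall x : R, 0 < x -> 0 <= df x) ->
  forall x y : R, 0 < x -> x <= y -> f x <= f y.
Proof.
move=> fdf df0 x y x0 xy.
have dfz z : z \in `]x, y[%R -> is_derive z 1 f (df z).
  by rewrite in_itv /= => /andP[xz _]; apply: fdf; exact: lt_trans xz.
have [|z] := MVT_segment xy dfz.
  apply: derivable_within_continuous => z; rewrite in_itv /= => /andP[xz _].
  by have [] := fdf z (lt_le_trans x0 xz).
rewrite in_itv /= => /andP[xz _] e; rewrite -subr_ge0 e.
by rewrite mulr_ge0 ?subr_ge0// df0// (lt_le_trans x0).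
Qed.

(** [O] is the integral of exp(-t^2) from 0 to x, written as half a difference of integrals from -oo
    so that it is visibly odd; [c] is its supremum. *)
Lemma error_function : exists (O : R -> R) (c : R), [/\ 0 < c,
  forall x : R, is_derive x 1 O (expR (- x ^+ 2)),
  forall x, O (- x) = - O x & O x @[x --> +oo] --> c].
Proof.
pose mu := @lebesgue_measure R.
pose E x := (\int[mu]_(t in `]-oo, x]) gauss_fun t)%R.
have iE x : mu.-integrable `]-oo, x] (EFin \o gauss_fun).
  by apply: integrableS integrableT_gauss.
have dE (x : R) : is_derive x 1 E (gauss_fun x).
  have cg : {for x, continuous (@gauss_fun R)} by exact: continuous_gauss_fun.
  have xx1 : x < x + 1 by rewrite ltrDl.
  have [d1 d2] := continuous_FTC1 xx1 (iE (x + 1)) (ltNyr _) cg.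
  by apply: DeriveDef; [exact: d1|rewrite -derive1E; exact: d2].
pose I := (\int[mu]_t gauss_fun t)%R.
have EI x : 0 <= E x <= I.
  apply/andP; split; first by apply: Rintegral_ge0 => y _; exact: gauss_fun_ge0.
  apply: fine_le.
  - exact: integrable_fin_num (iE x).
  - exact: integrable_fin_num integrableT_gauss.
  - apply: ge0_subset_integral => //=.
      by apply/measurable_EFinP; exact: measurable_gauss_fun.
    by move=> y _; rewrite lee_fin gauss_fun_ge0.
pose O x := 2^-1 * (E x - E (- x)).
have dO (x : R) : is_derive x 1 O (expR (- x ^+ 2)).
  have dN : is_derive x 1 (fun y : R => E (- y)) (- gauss_fun (- x)).
    have d1 : is_derive (- x) 1 E (gauss_fun (- x)) by [].
    have := @is_derive1_comp R E (fun y => - y) x _ _ d1 (is_deriveN (is_derive_id x 1)).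
    by rewrite mulrN1.
  apply: is_derive_eq (is_deriveZ (2^-1) (is_deriveB (dE x) dN)) _.
  by rewrite /gauss_fun sqrrN /GRing.scale /=; field.
have O0 : O 0 = 0 by rewrite /O oppr0 subrr mulr0.
have incO x y : x <= y -> O x <= O y.
  move=> xy.
  have [|z _ e] := MVT_segment xy (f := O) (fun z _ => dO z).
    by apply: derivable_within_continuous => z _; have [] := dO z.
  by rewrite -subr_ge0 e mulr_ge0 ?expR_ge0 ?subr_ge0.
have bO : has_ubound (range O).
  exists (2^-1 * I) => _ [x _ <-]; rewrite /O ler_wpM2l ?invr_ge0//.
  by have /andP[_ ?] := EI x; have /andP[? _] := EI (- x); lra.
exists O, (sup (range O)); split => //.
- have : 0 < O 1.
    have [|z _] := MVT_segment ler01 (f := O) (fun z _ => dO z).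
      by apply: derivable_within_continuous => z _; have [] := dO z.
    by rewrite O0 !subr0 mulr1 => ->; exact: expR_gt0.
  by move/lt_le_trans; apply; apply: ub_le_sup => //; exists 1.
- by move=> x; rewrite /O opprK -mulrN opprB.
- by apply: nondecreasing_cvgr.
Qed.

End GaussianMixtures.

(** * Exponentials of -|t| as mixtures of Gaussians *)

Section MixtureLemma.
Context {R : realType}.
Local Open Scope classical_set_scope.

Lemma cvgn_pinfty_affine (u : nat -> R) (A B : R) : 0 < B ->
  (forall k, B * k%:R - A <= u k) -> u k @[k --> \oo] --> +oo.
Proof.
move=> B0 uB; apply/cvgryPge => M; near=> k; apply: le_trans (uB k).
rewrite lerBrDr -ler_pdivrMl//.
by near: k; exact: nbhs_infty_ger.
Unshelve. all: end_near. Qed.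

Section Primitive.
Variables (O : R -> R) (c n b : R).
Hypotheses (dO : forall x : R, is_derive x 1 O (expR (- x ^+ 2))).
Hypotheses (ON : forall x, O (- x) = - O x) (cO : O x @[x --> +oo] --> c).
Hypotheses (n1 : 1 <= n) (b0 : 0 <= b).

(** The exponential factors compensate the cross terms of (n x - b/x)^2 and (n x + b/x)^2.
    Subtracting [c] in the second summand makes the limits at +oo and at 0 opposite: c exp(-2 n b)
    and its negative. *)
Let V x := expR (- (2 * n * b)) * O (n * x - b / x)
  + expR (2 * n * b) * (O (n * x + b / x) - c).

(** Once the cross terms cancel, both summands carry the same Gaussian, and the inner derivatives n
    + b/x^2 and n - b/x^2 add up to 2 n. *)
Lemma is_derive_mixture_primitive (x : R) : 0 < x ->
  is_derive x 1 V (2 * n * expR (- ((n * x) ^+ 2 + (b / x) ^+ 2))).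
Proof.
move=> x0; have xn0 : x != 0 by rewrite gt_eqF.
have dI : is_derive x 1 (fun y : R => y^-1) (- x ^- 2).
  apply: is_derive_eq (is_deriveV _ (is_derive_id x 1)) _ => //.
  by rewrite /GRing.scale /= mulr1.
have dL (e : R) : is_derive x 1 (fun y : R => n * y + e * (b / y)) (n - e * (b / x ^+ 2)).
  apply: is_derive_eq (is_deriveD (is_deriveZ n (is_derive_id x 1))
     (is_deriveZ e (is_deriveZ b dI))) _.
  by rewrite /GRing.scale /=; field.
have dOL (e : R) : is_derive x 1 (fun y : R => O (n * y + e * (b / y)))
    ((n - e * (b / x ^+ 2)) * expR (- (n * x + e * (b / x)) ^+ 2)).
  by apply: is_derive_eq (is_derive1_comp _ (dL e)) _; rewrite mulrC.
have -> : V = fun y => expR (- (2 * n * b)) * O (n * y + -1 * (b / y))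
  + expR (2 * n * b) * (O (n * y + 1 * (b / y)) - c).
  by apply/funext => y; rewrite /V mulN1r mul1r.
apply: is_derive_eq (is_deriveD (is_deriveZ _ (dOL (-1)))
  (is_deriveZ _ (is_deriveB (dOL 1) (is_derive_cst c x 1)))) _.
rewrite /GRing.scale /= subr0 !mulN1r !mul1r.
rewrite !(mulrCA (expR _)) -!expRD.
have -> : - (2 * n * b) - (n * x - b / x) ^+ 2 = - ((n * x) ^+ 2 + (b / x) ^+ 2).
  by field.
have -> : 2 * n * b - (n * x + b / x) ^+ 2 = - ((n * x) ^+ 2 + (b / x) ^+ 2).
  by field.
by ring.
Qed.

Lemma mixture_primitive_cvgy :
  V k.+1%:R @[k --> \oo] --> c * expR (- (2 * n * b)).
Proof.
have c1 : O (n * k.+1%:R - b / k.+1%:R) @[k --> \oo] --> c.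
  apply: cvg_comp cO; apply: (@cvgn_pinfty_affine _ b 1) => // k.
  rewrite mul1r lerB//.
    by rewrite -[leLHS]mul1r ler_pM// ler_nat.
  by rewrite ler_pdivrMr ?ltr0n// ler_peMr// ler1n.
have c2 : O (n * k.+1%:R + b / k.+1%:R) @[k --> \oo] --> c.
  apply: cvg_comp cO; apply: (@cvgn_pinfty_affine _ 0 1) => // k.
  rewrite mul1r subr0 -[leLHS]addr0 lerD ?divr_ge0//.
  by rewrite -[leLHS]mul1r ler_pM// ler_nat.
have -> : c * expR (- (2 * n * b))
    = expR (- (2 * n * b)) * c + expR (2 * n * b) * (c - c) by ring.
apply: cvgD; apply: cvgMl_tmp => //.
by apply: cvgB => //; exact: cvg_cst.
Qed.

Lemma mixture_primitive_cvg0 :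
  V k.+1%:R^-1 @[k --> \oo] --> - (c * expR (- (2 * n * b))).
Proof.
(* For b = 0 both arguments of [O] tend to 0, for b > 0 they tend to -oo and +oo; the limit of [V]
   has the same expression in both cases. *)
have [b_gt0|] := ltP 0 b; last first.
  move=> b_le0; have be : b = 0 by apply/eqP; rewrite eq_le b_le0.
  have O0 : O 0 = 0 by have := ON 0; rewrite oppr0; lra.
  have c1 : O (n * k.+1%:R^-1) @[k --> \oo] --> 0.
    rewrite -O0; apply: continuous_cvg.
      by apply: differentiable_continuous; apply/derivable1_diffP; have [] := dO 0.
    rewrite -[X in _ --> X](mulr0 n); apply: cvgMl_tmp; exact: cvg_harmonic.
  have -> : - (c * expR (- (2 * n * b)))
      = expR (- (2 * n * b)) * 0 + expR (2 * n * b) * (0 - c).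
    by rewrite be !mulr0 oppr0 expR0; ring.
  rewrite /V be; apply: cvgD; apply: cvgMl_tmp.
    by under eq_fun do rewrite mul0r subr0.
  apply: cvgB; last exact: cvg_cst.
  by under eq_fun do rewrite mul0r addr0.
have c1 : O (n * k.+1%:R^-1 - b / k.+1%:R^-1) @[k --> \oo] --> - c.
  suff : O (b * k.+1%:R - n * k.+1%:R^-1) @[k --> \oo] --> c.
    move/cvgN => h; apply: cvg_trans h; apply: near_eq_cvg; near=> k.
    by rewrite fctE invrK -ON opprB.
  apply: cvg_comp cO; apply: (@cvgn_pinfty_affine _ n b) => // k.
  rewrite lerB//; first by rewrite ler_wpM2l// ler_nat.
  by rewrite ler_piMr ?(le_trans _ n1)// invf_le1 ?ltr0n// ler1n.
have c2 : O (n * k.+1%:R^-1 + b / k.+1%:R^-1) @[k --> \oo] --> c.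
  apply: cvg_comp cO; apply: (@cvgn_pinfty_affine _ 0 b) => // k.
  rewrite invrK subr0 -[leLHS]add0r lerD//.
    by rewrite mulr_ge0 ?invr_ge0// (le_trans _ n1).
  by rewrite ler_wpM2l// ler_nat.
have -> : - (c * expR (- (2 * n * b)))
    = expR (- (2 * n * b)) * - c + expR (2 * n * b) * (c - c) by ring.
apply: cvgD; apply: cvgMl_tmp => //.
by apply: cvgB => //; exact: cvg_cst.
Unshelve. all: end_near. Qed.

End Primitive.

(* The classical formula
     e^(-2 n t) = (2 n / sqrt pi) int_0^oo e^(-n^2 x^2 - t^2 / x^2) dx
   exhibits the combination of exponentials as a mixture of the Gaussians
   e^(-t^2 / x^2) with the density assumed nonnegative. Instead of integrating,
   we use that an explicit primitive of the integrand is nondecreasing. *)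
Lemma pdf_expR_abs_sum (c : nat -> R) N (b : R) : 0 <= b ->
  (forall x, 0 < x ->
     0 <= \sum_(0 <= i < N) c i * i.+1%:R * expR (- (i.+1%:R * x) ^+ 2)) ->
  pdf (fun t => \sum_(0 <= i < N) c i * expR (- (2 * i.+1%:R * (b * `|t|)))).
Proof.
move=> b0 c_ge0 T p l l0 s.
have [ O [C [C0 dO ON cO]]] := @error_function R.
pose V (i : nat) (B x : R) := let n := i.+1%:R in
  expR (- (2 * n * B)) * O (n * x - B / x)
  + expR (2 * n * B) * (O (n * x + B / x) - C).
pose B (u v : R * T) := b * `|p u.2 - p v.2|.
have B0 u v : 0 <= B u v by rewrite mulr_ge0.
pose a (u v : R * T) := u.1 * v.1 * l u.2 v.2.
pose F x := \sum_(u <- s) \sum_(v <- s) a u v *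
  \sum_(i <- index_iota 0 N) c i * V i (B u v) x.
pose Q := \sum_(u <- s) \sum_(v <- s) a u v *
  \sum_(i <- index_iota 0 N) c i * expR (- (2 * i.+1%:R * B u v)).
have QE : qform (fun x y => (\sum_(0 <= i < N)
    c i * expR (- (2 * i.+1%:R * (b * `|p x - p y|)))) * l x y) s = Q.
  apply: eq_bigr => u _; apply: eq_bigr => v _.
  by rewrite /a /B [_ * l _ _]mulrC mulrA.
rewrite QE.
have n1 i : 1 <= i.+1%:R :> R by rewrite ler1n.
have dF (x : R) : 0 < x -> is_derive x 1 F (\sum_(u <- s) \sum_(v <- s) a u v *
    \sum_(i <- index_iota 0 N) c i *
      (2 * i.+1%:R * expR (- ((i.+1%:R * x) ^+ 2 + (B u v / x) ^+ 2)))).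
  move=> x0; apply: is_derive_bigsum => u; apply: is_derive_bigsum => v.
  apply: is_deriveZ; apply: is_derive_bigsum => i; apply: is_deriveZ.
  exact: is_derive_mixture_primitive.
(* The factor exp(-(B u v / x)^2) is independent of [i], so the derivative is the density, assumed
   nonnegative, times the form of a Gaussian kernel. *)
have dF0 (x : R) : 0 < x -> 0 <= \sum_(u <- s) \sum_(v <- s) a u v *
    \sum_(i <- index_iota 0 N) c i *
      (2 * i.+1%:R * expR (- ((i.+1%:R * x) ^+ 2 + (B u v / x) ^+ 2))).
  move=> x0; set S := \sum_(0 <= i < N) c i * i.+1%:R * expR (- (i.+1%:R * x) ^+ 2).
  suff -> : \sum_(u <- s) \sum_(v <- s) a u v *
    \sum_(i <- index_iota 0 N) c i *
      (2 * i.+1%:R * expR (- ((i.+1%:R * x) ^+ 2 + (B u v / x) ^+ 2)))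
    = 2 * S * qform (fun y z => expR (- ((b / x) ^+ 2 * (p y - p z) ^+ 2)) * l y z) s.
    rewrite mulr_ge0 ?mulr_ge0 ?c_ge0//.
    by apply: pdf_gauss; rewrite ?sqr_ge0.
  rewrite /qform mulr_sumr; apply: eq_bigr => u _.
  rewrite mulr_sumr; apply: eq_bigr => v _.
  rewrite /S mulr_sumr [2 * _]mulr_sumr mulr_suml; apply: eq_bigr => i _.
  have -> : (B u v / x) ^+ 2 = (b / x) ^+ 2 * (p u.2 - p v.2) ^+ 2.
    rewrite -(real_normK (num_real (p u.2 - p v.2))) /B.
    by rewrite -exprMn; congr (_ ^+ 2); ring.
  by rewrite opprD expRD /a; ring.
have cvF (x : nat -> R) e : (forall i u v, V i (B u v) (x k) @[k --> \oo]
    --> e * (C * expR (- (2 * i.+1%:R * B u v)))) ->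
    F (x k) @[k --> \oo] --> e * C * Q.
  move=> cV; have -> : e * C * Q = \sum_(u <- s) \sum_(v <- s) a u v *
      \sum_(i <- index_iota 0 N)
        c i * (e * (C * expR (- (2 * i.+1%:R * B u v)))).
    rewrite /Q mulr_sumr; apply: eq_bigr => u _.
    rewrite mulr_sumr; apply: eq_bigr => v _.
    rewrite mulrCA; congr (_ * _); rewrite mulr_sumr; apply: eq_bigr => i _.
    by ring.
  apply: cvgr_sum => u; apply: cvgr_sum => v.
  apply: cvgMl_tmp; apply: cvgr_sum => i; apply: cvgMl_tmp; exact: cV.
have cy : F k.+1%:R @[k --> \oo] --> 1 * C * Q.
  by apply: cvF => i u v; rewrite mul1r; exact: mixture_primitive_cvgy.
have c0 : F k.+1%:R^-1 @[k --> \oo] --> -1 * C * Q.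
  by apply: cvF => i u v; rewrite mulN1r; exact: mixture_primitive_cvg0.
(* [F] is nondecreasing with limits -C Q at 0 and C Q at +oo; compare it at 1/(k + 1) and k + 1. *)
have : -1 * C * Q <= 1 * C * Q.
  apply: ler_cvg_to c0 cy _; apply: nearW => k.
  apply: (gt0_is_derive_le dF dF0); first by rewrite invr_gt0.
  by rewrite (@le_trans _ _ 1)// ?invf_le1// ler1n.
by rewrite mulN1r mul1r -subr_ge0 mulNr opprK -mulr2n pmulrn_lge0// pmulr_rge0.
Qed.

Lemma pdf_expR_abs (b : R) : 0 <= b -> pdf (fun t => expR (- (b * `|t|))).
Proof.
move=> b0; have b2 : 0 <= b / 2 by rewrite divr_ge0.
apply: eq_pdf (pdf_expR_abs_sum (c := fun=> 1) (N := 1) b2 _).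
  by move=> t; rewrite big_nat1 mul1r; congr expR; field.
by move=> x x0; rewrite big_nat1 !mul1r expR_ge0.
Qed.

End MixtureLemma.

(** * Gauss's product for the theta function, in finite form *)

Section ThetaMonotone.
Context {R : realType}.
Local Open Scope classical_set_scope.
Implicit Types (q mu : R) (n i s : nat).

Definition theta4_part n q : R := 1 + 2 * \sum_(0 <= i < n) (-1) ^+ i.+1 * q ^+ (i.+1 ^ 2).

Definition gauss_prod n q : R := \prod_(0 <= i < n) ((1 - q ^+ i.+1) / (1 + q ^+ i.+1)).

Lemma gauss_prodS n q :
  gauss_prod n.+1 q = gauss_prod n q * ((1 - q ^+ n.+1) / (1 + q ^+ n.+1)).
Proof. by rewrite /gauss_prod big_nat_recr. Qed.

Lemma gauss_factor_gt0 q n : 0 < q < 1 -> 0 < (1 - q ^+ n.+1) / (1 + q ^+ n.+1).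
Proof.
move=> /andP[q0 q1]; rewrite divr_gt0// ?subr_gt0 ?exprn_ilt1// ?ltW//.
by rewrite addr_gt0 ?exprn_gt0.
Qed.

Lemma gauss_prod_gt0 q n : 0 < q < 1 -> 0 < gauss_prod n q.
Proof. by move=> q01; apply: prodr_gt0 => i _; exact: gauss_factor_gt0. Qed.

Lemma gauss_prod_nincr_n q n s : 0 < q < 1 -> (s <= n)%N -> gauss_prod n q <= gauss_prod s q.
Proof.
move=> q01 /subnK <-; elim: (n - s)%N => // k IH; apply: le_trans IH.
rewrite addSn gauss_prodS ler_piMr ?(ltW (gauss_prod_gt0 _ q01))//.
case/andP: q01 => q0 q1; have e0 : 0 < q ^+ (k + s).+1 by rewrite exprn_gt0.
by rewrite ler_pdivrMr ?addr_gt0// mul1r; lra.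
Qed.

(** Each factor (1 - y) / (1 + y) decreases in y = q^(i + 1). This is the source of the monotonicity
    of theta. *)
Lemma gauss_prod_nincr q q' n : 0 < q -> q <= q' -> q' < 1 -> gauss_prod n q' <= gauss_prod n q.
Proof.
move=> q0 qq' q1; apply: ler_prod => i _; apply/andP; split.
  by apply/ltW/gauss_factor_gt0; rewrite q1 (lt_le_trans q0).
have e0 : 0 < q ^+ i.+1 by rewrite exprn_gt0.
have e1 : q ^+ i.+1 <= q' ^+ i.+1 by rewrite lerXn2r ?nnegrE ?(ltW q0)// (le_trans (ltW q0)).
have e0' := lt_le_trans e0 e1.
rewrite ler_pdivrMr ?addr_gt0// mulrAC ler_pdivlMr ?addr_gt0//.
by nra.
Qed.

(* Shanks' finite form of Gauss's identity
   1 + 2 sum_(s >= 1) (-1)^s q^(s^2) = prod_(k >= 1) (1 - q^k) / (1 + q^k). *)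
Let shanks_term q n s : R := (-1) ^+ s * (gauss_prod n q / gauss_prod s q)
  * (2 * q ^+ (s * n.+1) / (1 + q ^+ s)).

Lemma theta4_part_shanks q n : 0 < q < 1 ->
  theta4_part n q = \sum_(0 <= s < n.+1) shanks_term q n s.
Proof.
move=> q01; have /andP[q0 q1] := q01.
have pos k : 1 + q ^+ k != 0 by rewrite gt_eqF// addr_gt0// exprn_gt0.
have neg k : 1 - q ^+ k.+1 != 0.
  by rewrite gt_eqF// subr_gt0 exprn_ilt1// ltW.
have P0 k : gauss_prod k q != 0 by rewrite gt_eqF// gauss_prod_gt0.
elim: n => [|n IH].
  rewrite /theta4_part /shanks_term big_nat1 big_nil !expr0 mul1r divff// mulr0.
  by rewrite addr0; field.
have -> : theta4_part n.+1 q = theta4_part n q + 2 * ((-1) ^+ n.+1 * q ^+ (n.+1 ^ 2)).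
  by rewrite /theta4_part big_nat_recr//= mulrDr addrA.
rewrite {}IH [RHS]big_nat_recr//=.
(* [U] is a telescoping certificate: raising [n] by one changes the term of index s + 1 by
   [U s - U s.+1] and the term of index 0 by [- U 0]. *)
pose U s : R := (-1) ^+ s * (gauss_prod n q / gauss_prod s q)
  * (2 * q ^+ (s.+1 * n.+1) / (1 + q ^+ n.+1)).
have step s : shanks_term q n.+1 s.+1 = shanks_term q n s.+1 + (U s - U s.+1).
  rewrite /shanks_term /U !gauss_prodS (mulnS s.+1) (mulSn s.+1) !exprD (exprS (-1) s).
  move: (neg n) (neg s) (pos n.+1) (pos s.+1) (P0 n) (P0 s).
  set Y := q ^+ n.+1; set Z := q ^+ s.+1; set X := q ^+ (s.+1 * n.+1).
  move: X Y Z (gauss_prod n q) (gauss_prod s q) ((-1) ^+ s) => X Y Z P Q e *.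
  by field; do !(apply/andP; split).
have tel : \sum_(0 <= s < n) (U s - U s.+1) = U 0%N - U n.
  rewrite (@telescope_sumr_eq _ 0 n (fun s => - U s))// => [|k _] /=; by ring.
have tele : \sum_(0 <= s < n.+1) shanks_term q n.+1 s
    = \sum_(0 <= s < n.+1) shanks_term q n s - U n.
  rewrite !big_nat_recl//.
  under eq_bigr do rewrite step.
  rewrite big_split /= tel.
  have -> : shanks_term q n.+1 0 = shanks_term q n 0 - U 0%N.
    rewrite /shanks_term /U gauss_prodS !mul0n mul1n !expr0.
    have -> : gauss_prod 0 q = 1 by rewrite /gauss_prod big_nil.
    by move: (pos n.+1) => ?; field.
  by ring.
(* The leftover [- U n] and the new term s = n + 1 have powers (n + 1)^2 and (n + 1)^2 + (n + 1) of
   q, so the denominator 1 + q^(n + 1) cancels. *)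
rewrite tele -addrA; congr (_ + _).
rewrite /shanks_term /U !divff// (mulnS n.+1 n.+1) exprD -mulnn (exprS (-1) n).
move: (pos n.+1); set Y := q ^+ n.+1 => ?.
by field.
Qed.

End ThetaMonotone.

(** * Almost positivity of alternating Gaussian sums *)

Section AlternatingGaussianSums.
Context {R : realType}.
Local Open Scope classical_set_scope.
Implicit Types (q mu : R) (n i s : nat).

(** In Shanks' form the term s = 0 is the product itself. Each of the other [n] terms contains q^(s
    (n + 1)) with s >= 1 and a quotient of products at most 1, hence is at most 2 q^(n + 1) in
    absolute value. *)
Lemma gauss_identity_error q n : 0 < q < 1 ->
  `|theta4_part n q - gauss_prod n q| <= 2 * n%:R * q ^+ n.+1.
Proof.
move=> q01; have /andP[q0 q1] := q01.
rewrite theta4_part_shanks// big_nat_recl// expr0 mul0n expr0 mul1r.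
have -> : gauss_prod 0 q = 1 by rewrite /gauss_prod big_nil.
rewrite divr1 mulr1.
have -> : 2 / (1 + 1) = 1 :> R by field.
rewrite mulr1 addrC addKr.
apply: le_trans (ler_norm_sum _ _ _) _.
rewrite [leRHS](_ : _ = \sum_(0 <= i < n) 2 * q ^+ n.+1); last first.
  by rewrite sumr_const_nat subn0 -mulr_natr; ring.
apply: ler_sum_nat => i /andP[_ ilt].
have Pi := gauss_prod_gt0 i.+1 q01; have Pn := gauss_prod_gt0 n q01.
have qi k : 0 < q ^+ k by rewrite exprn_gt0.
rewrite 2!(normrM (_ * _)) (normrM (_ ^+ _)) normrX normrN1 expr1n mul1r.
have F0 : 0 <= gauss_prod n q / gauss_prod i.+1 q by rewrite divr_ge0 ?ltW.
have G0 : 0 < 1 + q ^+ i.+1 by rewrite addr_gt0.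
rewrite (ger0_norm F0) normfV (gtr0_norm G0) ger0_norm ?mulr_ge0 ?(ltW (qi _))//.
rewrite -[leRHS]mul1r ler_pM//.
- by rewrite divr_ge0 ?mulr_ge0 ?(ltW (qi _)) ?(ltW G0).
- by rewrite ler_pdivrMr// mul1r gauss_prod_nincr_n.
rewrite ler_pdivrMr//.
have le1 : q ^+ (i.+1 * n.+1) <= q ^+ n.+1.
  by rewrite mulSn exprD ler_piMr ?(ltW (qi _))// exprn_ile1// ltW.
have := mulr_gt0 (qi n.+1) (qi i.+1).
by lra.
Qed.

(** Compare both partial sums with the products, which are exactly monotone; each comparison costs
    at most 2 n q'^(n + 1). *)
Lemma theta4_part_nincr q q' n : 0 < q -> q <= q' -> q' < 1 ->
  theta4_part n q' <= theta4_part n q + 4 * n%:R * q' ^+ n.+1.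
Proof.
move=> q0 qq' q1.
have q'0 := lt_le_trans q0 qq'; have qlt1 := le_lt_trans qq' q1.
have := gauss_prod_nincr n q0 qq' q1.
have : `|theta4_part n q' - gauss_prod n q'| <= 2 * n%:R * q' ^+ n.+1.
  by apply: gauss_identity_error; rewrite q'0.
have : `|theta4_part n q - gauss_prod n q| <= 2 * n%:R * q ^+ n.+1.
  by apply: gauss_identity_error; rewrite q0.
have : 2 * n%:R * q ^+ n.+1 <= 2 * n%:R * q' ^+ n.+1.
  by rewrite ler_wpM2l ?mulr_ge0// lerXn2r ?nnegrE ?(ltW q0) ?(ltW q'0).
by rewrite !ler_norml => ? /andP[? ?] /andP[? ?] ?; lra.
Qed.

Lemma expRN_le_quad (x : R) : 0 <= x -> 1 - x <= expR (- x) <= 1 - x + x ^+ 2.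
Proof.
move=> x0; apply/andP; split; first exact: expR_ge1Dx.
have Q0 : 0 <= 1 - x + x ^+ 2 by nra.
rewrite expRN -div1r ler_pdivrMr ?expR_gt0//.
apply: le_trans (ler_wpM2l Q0 (expR_ge1Dx x)).
have x30 : 0 <= x ^+ 3 by rewrite exprn_ge0.
have -> : (1 - x + x ^+ 2) * (1 + x) = 1 + x ^+ 3 by ring.
by lra.
Qed.

(** The right-hand side is half the derivative in nu, at nu = mu + x^2, of the theta partial sum at
    q = exp(-nu). Approximate monotonicity bounds the difference quotient of step [h] from below,
    and a second-order bound on the exponential compares it with the derivative. Both errors keep a
    factor exp(-x^2), which makes the estimate usable for all [x] at once. *)
Lemma alternating_sum_lower (mu h x : R) n : 0 < mu -> 0 < h ->
  - (2 * n%:R / h * expR (- mu * n.+1%:R)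
     + h * \sum_(0 <= i < n) i.+1%:R ^+ 4 * expR (- (mu * i.+1%:R ^+ 2))) * expR (- x ^+ 2)
  <= \sum_(0 <= i < n) (-1) ^+ i * i.+1%:R ^+ 2 *
       expR (- ((mu + x ^+ 2) * i.+1%:R ^+ 2)).
Proof.
move=> mu0 h0; set nu := mu + x ^+ 2.
have x20 : 0 <= x ^+ 2 by exact: sqr_ge0.
have nu0 : 0 < nu by rewrite ltr_wpDr.
have th y : theta4_part n (expR (- y)) =
    1 - 2 * \sum_(0 <= i < n) (-1) ^+ i * expR (- (y * i.+1%:R ^+ 2)).
  rewrite /theta4_part; congr (1 + _); rewrite -mulrN; congr (2 * _).
  rewrite -sumrN; apply: eq_bigr => i _; rewrite exprS mulN1r mulNr.
  by rewrite -expRM_natr natrX mulNr.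
have := @theta4_part_nincr (expR (- (nu + h))) (expR (- nu)) n (expR_gt0 _).
rewrite ler_expR expR_lt1 oppr_lt0 lerN2 lerDl => /(_ (ltW h0) nu0).
rewrite !th.
set A := \sum_(_ <= _ < _) _; set B := \sum_(_ <= _ < _) _ => AB.
have AB' : - (2 * n%:R * expR (- nu) ^+ n.+1) <= A - B by lra.
have {AB AB'} AB : - (2 * n%:R / h * expR (- mu * n.+1%:R)) * expR (- x ^+ 2) <= (A - B) / h.
  rewrite ler_pdivlMr//; apply: le_trans AB'.
  have -> : - (2 * n%:R / h * expR (- mu * n.+1%:R)) * expR (- x ^+ 2) * h
      = - (2 * n%:R * (expR (- mu * n.+1%:R) * expR (- x ^+ 2))).
    by field; rewrite gt_eqF.
  rewrite lerN2 ler_wpM2l// -expRM_natr -expRD ler_expR /nu.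
  have := ler_peMr x20 (_ : 1 <= n.+1%:R); rewrite ler1n => /(_ isT).
  by lra.
set M := \sum_(_ <= _ < _) _; set C := \sum_(_ <= _ < _) _.
rewrite opprD mulrDl.
have : `|(A - B) / h - C| <= h * M * expR (- x ^+ 2).
  rewrite -sumrB mulr_suml -sumrB; apply: le_trans (ler_norm_sum _ _ _) _.
  rewrite [leRHS]mulrAC mulr_sumr; apply: ler_sum => i _.
  set s := i.+1%:R; have s1 : 1 <= s :> R by rewrite ler1n.
  have -> : (-1) ^+ i * expR (- (nu * s ^+ 2)) - (-1) ^+ i * expR (- ((nu + h) * s ^+ 2))
      = (-1) ^+ i * expR (- (nu * s ^+ 2)) * (1 - expR (- (h * s ^+ 2))).
    have -> : - ((nu + h) * s ^+ 2) = - (nu * s ^+ 2) + - (h * s ^+ 2) by ring.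
    by rewrite expRD; ring.
  set E := expR (- (h * s ^+ 2)).
  have -> : (-1) ^+ i * expR (- (nu * s ^+ 2)) * (1 - E) / h -
       (-1) ^+ i * s ^+ 2 * expR (- (nu * s ^+ 2))
     = (-1) ^+ i * (expR (- (nu * s ^+ 2)) * ((1 - E) / h - s ^+ 2)) by field; rewrite gt_eqF.
  rewrite normrM normrX normrN1 expr1n mul1r normrM gtr0_norm ?expR_gt0//.
  have hs0 : 0 <= h * s ^+ 2 by rewrite mulr_ge0 ?sqr_ge0// ltW.
  have /andP[E1 E2] := expRN_le_quad hs0.
  have e1 : `|(1 - E) / h - s ^+ 2| <= h * s ^+ 4.
    have -> : (1 - E) / h - s ^+ 2 = (1 - E - h * s ^+ 2) / h by field; rewrite gt_eqF.
    rewrite normrM normfV (gtr0_norm h0) ler_pdivrMr// ler_norml; apply/andP.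
    by split; rewrite -/E in E1 E2; nra.
  have e2 : expR (- (nu * s ^+ 2)) <= expR (- x ^+ 2) * expR (- (mu * s ^+ 2)).
    rewrite -expRD ler_expR /nu.
    have : x ^+ 2 <= x ^+ 2 * s ^+ 2 by rewrite ler_peMr// expr_ge1// (le_trans ler01).
    by lra.
  have -> : h * expR (- x ^+ 2) * (s ^+ 4 * expR (- (mu * s ^+ 2)))
     = (expR (- x ^+ 2) * expR (- (mu * s ^+ 2))) * (h * s ^+ 4) by ring.
  by rewrite ler_pM ?expR_ge0.
rewrite ler_norml => /andP[_]; lra.
Qed.

End AlternatingGaussianSums.

(** * Convergence of Gaussian series and positive definiteness of their sums *)

Section GaussianSeries.
Context {R : realType}.
Local Open Scope classical_set_scope.
Implicit Types (mu : R) (n i : nat).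

Lemma sum_telescope_harmonic n :
  \sum_(0 <= i < n) (i.+1%:R^-1 - i.+2%:R^-1) <= 1 :> R.
Proof.
rewrite (@telescope_sumr_eq _ 0 n (fun i => - (i.+1%:R^-1 : R)))//.
  by rewrite invr1 opprK gerDr oppr_le0 invr_ge0.
by move=> k _; rewrite opprK addrC.
Qed.

(** For s >= 1, exp(-mu s^2) <= exp(-mu s) <= (m + 2)! / (mu s)^(m + 2), and 1/s^2 <= 2 (1/s - 1/(s
    + 1)). The majorant telescopes, so its partial sums are at most [C]. *)
Lemma gauss_moment m mu : 0 < mu -> exists C : R, 0 <= C /\
  forall i, i.+1%:R ^+ m * expR (- (mu * i.+1%:R ^+ 2))
    <= C * (i.+1%:R^-1 - i.+2%:R^-1).
Proof.
move=> mu0; exists (2 * ((m.+2)`!%:R / mu ^+ m.+2)); split.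
  by rewrite mulr_ge0// divr_ge0// exprn_ge0// ltW.
move=> i; have -> : i.+2%:R = i.+1%:R + 1 :> R by rewrite -natr1.
set s := i.+1%:R; have s1 : 1 <= s :> R by rewrite ler1n.
have s0 : 0 < s by exact: lt_le_trans s1.
have F0 : 0 < (m.+2)`!%:R :> R by rewrite ltr0n fact_gt0.
have e1 : expR (- (mu * s ^+ 2)) <= (m.+2)`!%:R / (mu * s) ^+ m.+2.
  apply: (@le_trans _ _ (expR (- (mu * s)))).
    by rewrite ler_expR lerN2 ler_pM2l// expr2 ler_peMl// ltW.
  rewrite expRN -[leRHS]invf_div lef_pV2 ?posrE ?expR_gt0//.
    apply: le_trans (expR_ge1Dxn m.+1 (ltW (mulr_gt0 mu0 s0))).
    by rewrite lerDr.
  by rewrite divr_gt0// exprn_gt0// mulr_gt0.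
apply: le_trans (ler_wpM2l (exprn_ge0 m (ltW s0)) e1) _.
have -> : s ^+ m * ((m.+2)`!%:R / (mu * s) ^+ m.+2)
    = (m.+2)`!%:R / mu ^+ m.+2 * (s ^+ 2)^-1.
  rewrite exprMn -(addn2 m) (exprD s) invfM invfM.
  rewrite [_^-1 * _]mulrC; field.
  by rewrite !gt_eqF// ?exprn_gt0.
rewrite [2 * _]mulrC -[leRHS]mulrA ler_wpM2l ?divr_ge0 ?exprn_ge0 ?(ltW mu0)//.
have -> : s^-1 - (s + 1)^-1 = (s * (s + 1))^-1 by field; rewrite !gt_eqF// addr_gt0.
rewrite ler_pdivlMr ?mulr_gt0 ?addr_gt0// mulrC ler_pdivrMr ?exprn_gt0//.
by nra.
Qed.

Lemma is_cvg_sum_dominated (u : nat -> R) C : 0 <= C ->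
  (forall i, `|u i| <= C * (i.+1%:R^-1 - i.+2%:R^-1)) ->
  cvgn (fun n => \sum_(0 <= i < n) u i).
Proof.
move=> C0 uC; apply: (@normed_cvg _ R u); apply: nondecreasing_is_cvgn.
  by apply: (@nondecreasing_series _ (fun i => `|u i|) xpredT) => i _ _.
exists C => _ [n _ <-]; rewrite -[leRHS]mulr1.
apply: (le_trans _ (ler_wpM2l C0 (sum_telescope_harmonic n))).
by rewrite mulr_sumr /=; apply: ler_sum => i _; exact: uC.
Qed.

Lemma alternating_sum_near (mu d : R) : 0 < mu -> 0 < d ->
  \forall n \near \oo, forall x : R, 0 <= d * expR (- x ^+ 2) +
    \sum_(0 <= i < n) (-1) ^+ i * i.+1%:R ^+ 2 *
      expR (- ((mu + x ^+ 2) * i.+1%:R ^+ 2)).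
Proof.
move=> mu0 d0; have [C [C0 MC]] := gauss_moment 4 mu0.
(* The second error is at most h C <= d / 2; C + 1 keeps the denominator positive. [n] is chosen
   after [h]. *)
pose h := d / (2 * (C + 1)).
have h0 : 0 < h by rewrite divr_gt0// mulr_gt0// ltr_wpDl.
near=> n => x; apply: le_trans (lerD (lexx _) (alternating_sum_lower x n mu0 h0)).
set M := \sum_(0 <= i < n) _.
rewrite -mulrDl mulr_ge0 ?expR_ge0//.
have hM : h * M <= d / 2.
  have MC' : M <= C.
    apply: (@le_trans _ _ (\sum_(0 <= i < n) C * (i.+1%:R^-1 - i.+2%:R^-1))).
      by apply: ler_sum => i _; exact: MC.
    by rewrite -mulr_sumr -[leRHS]mulr1 ler_wpM2l// sum_telescope_harmonic.
  rewrite /h mulrAC ler_pdivrMr ?mulr_gt0 ?ltr_wpDl//.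
  have -> : d / 2 * (2 * (C + 1)) = d * (C + 1) by field.
  by rewrite ler_pM2l//; lra.
(* With [h] fixed, exp(-y) <= 2 / y^2 at y = mu (n + 1) makes the first error O(1/n). *)
have : 2 * n%:R / h * expR (- mu * n.+1%:R) <= d / 2.
  have y0 : 0 < mu * n.+1%:R by rewrite mulr_gt0.
  have e1 : expR (- mu * n.+1%:R) <= 2 / (mu * n.+1%:R) ^+ 2.
    rewrite mulNr expRN -[leRHS]invf_div lef_pV2 ?posrE ?expR_gt0 ?divr_gt0 ?exprn_gt0//.
    by apply: le_trans (expR_ge1Dxn 1 (ltW y0)); rewrite lerDr.
  have nh0 : 0 <= 2 * n%:R / h by rewrite divr_ge0// ltW.
  apply: le_trans (ler_wpM2l nh0 e1) _.
  rewrite exprMn ler_pdivlMr//.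
  have n8 : 8 / (h * mu ^+ 2 * d) <= n.+1%:R.
    by apply: (@le_trans _ _ n%:R); [near: n; exact: nbhs_infty_ger|rewrite ler_nat].
  have hm0 : 0 < h * mu ^+ 2 by rewrite mulr_gt0// exprn_gt0.
  have den0 : 0 < h * mu ^+ 2 * n.+1%:R by rewrite mulr_gt0.
  rewrite ler_pdivrMr ?(mulr_gt0 hm0)// in n8.
  have -> : 2 * n%:R / h * (2 / (mu ^+ 2 * n.+1%:R ^+ 2)) * 2
    = 8 / (h * mu ^+ 2 * n.+1%:R) * (n%:R / n.+1%:R).
    have m0 : 0 < n.+1%:R :> R by rewrite ltr0n.
    move: (n.+1%:R : R) m0 => m m0.
    by field; rewrite !gt_eqF.
  apply: (@le_trans _ _ (8 / (h * mu ^+ 2 * n.+1%:R) * 1)).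
    apply: ler_wpM2l; last by rewrite ler_pdivrMr ?ltr0n// mul1r ler_nat.
    by apply/ltW/divr_gt0; rewrite ?ltr0n.
  rewrite mulr1 ler_pdivrMr//.
  by apply: le_trans n8 _; rewrite le_eqVlt; apply/orP; left; apply/eqP; ring.
by lra.
Unshelve. all: end_near. Qed.

(** The mixing density of a long partial sum is bounded below by -d exp(-x^2). Adding [d] to the
    coefficient of index 0 makes it nonnegative, so phi + d e is positive definite in the limit, and
    then [d] tends to 0. *)
Lemma pdf_alternating (a mu : R) (phi : R -> R) : 0 < a -> 0 < mu ->
  (forall t, (\sum_(0 <= i < n) (-1) ^+ i * i.+1%:R
     * expR (- (mu * (a * i.+1%:R + `|t|) ^+ 2))) @[n --> \oo] --> phi t) ->
  pdf phi.
Proof.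
move=> a0 mu0 cphi.
pose S n (t : R) : R := \sum_(0 <= i < n) (-1) ^+ i * i.+1%:R
     * expR (- (mu * (a * i.+1%:R + `|t|) ^+ 2)).
pose e (t : R) : R := expR (- (mu * t ^+ 2)) * expR (- (2 * (mu * a) * `|t|)).
have ma0 : 0 < mu * a ^+ 2 by rewrite mulr_gt0 ?exprn_gt0.
have mua0 : 0 <= mu * a by rewrite mulr_ge0 ?ltW.
have main (d : R) : 0 < d -> pdf (fun t : R => phi t + d * e t).
  move=> d0; have [N _ NK] := alternating_sum_near ma0 d0.
  (* The offset N + 1 instead of N guarantees that every sum contains the index 0, which carries
     [d]. *)
  apply: (@pdf_cvg R (fun n (t : R) => S (n + N.+1)%N t + d * e t)
      (fun t : R => phi t + d * e t)); last first.
    move=> t; apply: cvgD; last exact: cvg_cst.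
    by have := cphi t; rewrite -(cvg_shiftn N.+1).
  move=> n.
  pose c i : R := (-1) ^+ i * i.+1%:R * expR (- (mu * a ^+ 2 * i.+1%:R ^+ 2))
     + d * (i == 0%N)%:R.
  have cE (f : nat -> R) : \sum_(0 <= i < n + N.+1) c i * f i
      = \sum_(0 <= i < n + N.+1) (-1) ^+ i * i.+1%:R
          * expR (- (mu * a ^+ 2 * i.+1%:R ^+ 2)) * f i + d * f 0%N.
    under eq_bigr do rewrite mulrDl.
    rewrite big_split /=; congr (_ + _).
    rewrite addnS big_nat_recl//= mulr1 big1 ?addr0// => i _.
    by rewrite mulr0 mul0r.
  have pc : pdf (fun t => \sum_(0 <= i < n + N.+1)
      c i * expR (- (2 * i.+1%:R * (mu * a * `|t|)))).
    apply: pdf_expR_abs_sum => // x _.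
    under eq_bigr do rewrite -mulrA.
    rewrite cE !mul1r addrC.
    have nN : (N <= n + N.+1)%N by rewrite addnS leqW// leq_addl.
    have := NK _ nN x; congr (_ <= _ + _); apply: eq_bigr => i _.
    rewrite (_ : - ((mu * a ^+ 2 + x ^+ 2) * i.+1%:R ^+ 2)
      = - (mu * a ^+ 2 * i.+1%:R ^+ 2) + - (i.+1%:R * x) ^+ 2); last by ring.
    by rewrite expRD; ring.
  apply: eq_pdf (pdfM (pdf_gauss (ltW mu0)) pc) => t.
  rewrite cE mulrDr /S /e mulr_sumr; congr (_ + _).
    apply: eq_bigr => i _.
    rewrite (_ : - (mu * (a * i.+1%:R + `|t|) ^+ 2) = - (mu * t ^+ 2)
      + - (mu * a ^+ 2 * i.+1%:R ^+ 2) + - (2 * i.+1%:R * (mu * a * `|t|))).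
      by rewrite !expRD; ring.
    by rewrite -(real_normK (num_real t)); ring.
  by rewrite mulrCA mulr1 !mulrA.
apply: (@pdf_cvg _ (fun n t => phi t + n.+1%:R^-1 * e t)) => [n|t].
  by apply: main; rewrite invr_gt0.
rewrite -[X in _ --> X]addr0; apply: cvgD; first exact: cvg_cst.
rewrite -[X in _ --> X](mul0r (e t)); apply: cvgMr_tmp; exact: cvg_harmonic.
Qed.

Lemma pdf_positive (a mu : R) (phi : R -> R) : 0 < a -> 0 < mu ->
  (forall t, (\sum_(0 <= i < n) i.+1%:R
     * expR (- (mu * (a * i.+1%:R + `|t|) ^+ 2))) @[n --> \oo] --> phi t) ->
  pdf phi.
Proof.
move=> a0 mu0; apply: (@pdf_cvg _ (fun n t => \sum_(0 <= i < n) i.+1%:R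
     * expR (- (mu * (a * i.+1%:R + `|t|) ^+ 2)))) => n.
apply: (@pdf_sum _ (fun i t => i.+1%:R * expR (- (mu * (a * i.+1%:R + `|t|) ^+ 2)))) => i.
apply: pdfZ => //; set s := i.+1%:R.
have b0 : 0 <= 2 * mu * a * s by rewrite !mulr_ge0// ltW.
have w0 : 0 <= expR (- (mu * (a * s) ^+ 2)) by exact: expR_ge0.
apply: eq_pdf (pdfZ w0 (pdfM (pdf_gauss (ltW mu0)) (pdf_expR_abs b0))) => t.
rewrite -!expRD; congr expR.
by rewrite -(real_normK (num_real t)); ring.
Qed.

End GaussianSeries.

(** * The interpolation kernels in one variable *)

Section OneDimensionalKernels.
Context {R : realType}.
Local Open Scope classical_set_scope.

Section FixedParameters.
Variables (a mu e : R).
Hypotheses (a0 : 0 < a) (mu0 : 0 < mu) (e2 : e ^+ 2 = 1).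

Let G (k : nat) (u : R) := expR (- (mu * (a * k%:R + u) ^+ 2)).
Let S (n : nat) (u : R) := \sum_(0 <= i < n) (- e) ^+ i * i.+1%:R * G i.+1 u.

Let G_moment : exists C : R, 0 <= C /\ forall i u, 0 <= u ->
  i.+1%:R * G i.+1 u <= C * (i.+1%:R^-1 - i.+2%:R^-1).
Proof.
have ma0 : 0 < mu * a ^+ 2 by rewrite mulr_gt0 ?exprn_gt0.
have [C [C0 MC]] := gauss_moment 1 ma0; exists C; split=> // i u u0.
apply: le_trans (MC i); rewrite expr1 ler_wpM2l// ler_expR lerN2 -mulrA -exprMn.
by rewrite ler_pM2l// lerXn2r ?nnegrE ?addr_ge0 ?mulr_ge0 ?(ltW a0)// lerDl.
Qed.

Let normNeX i : `|(- e) ^+ i| = 1.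
Proof.
have : `|e| ^+ 2 = 1 by rewrite real_normK ?num_real.
move/eqP; rewrite sqrf_eq1 => /orP[/eqP ee|/eqP ee]; last first.
  by have := normr_ge0 e; rewrite ee ler0N1.
by rewrite normrX normrN ee expr1n.
Qed.

Let cvgS u : 0 <= u -> cvgn (S ^~ u).
Proof.
move=> u0; have [C [C0 MC]] := G_moment.
apply: (is_cvg_sum_dominated (C := C)) => // i.
rewrite 2!normrM normNeX mul1r normr_nat ger0_norm ?expR_ge0//; exact: MC.
Qed.

(** Disposes of the boundary terms that telescoping leaves behind. *)
Let cvg_boundary (v : nat -> R) u : 0 <= u ->
  (forall n, 0 <= v n <= n.+1%:R * G n.+1 u) ->
  (- e) ^+ n * v n @[n --> \oo] --> 0.
Proof.
move=> u0 vG; have [C [C0 MC]] := G_moment.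
apply/norm_cvg0P => /=.
apply: (@squeeze_cvgr _ _ _ _ (cst 0) (fun n => C * n.+1%:R^-1)).
- near=> n; rewrite normr_ge0 /= normrM normNeX mul1r.
  have /andP[v0 vn] := vG n; rewrite ger0_norm//; apply: le_trans vn _.
  by apply: le_trans (MC n u u0) _; rewrite ler_wpM2l// gerBl.
- exact: cvg_cst.
- rewrite -[X in _ --> X](mulr0 C); apply: cvgMl_tmp.
  exact: cvg_harmonic.
Unshelve. all: end_near. Qed.

(** Shifting [u] by [a] shifts the index of [G]. Since e^2 = 1, the coefficient of an interior
    [G k u] is, up to sign, 2 k - (k - 1) - (k + 1) = 0; what survives is the index 0, reached from
    [S n (u - a)], and the upper boundary. *)
Let S_shift n u : 2 * S n u + e * (S n (u + a) + S n (u - a))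
  = e * G 0 u + (- e) ^+ n * (- e * (n.+1%:R * G n u) - n%:R * G n.+1 u).
Proof.
have Gp k : G k (u + a) = G k.+1 u.
  by rewrite /G -[k.+1%:R]natr1; congr expR; ring.
have Gm k : G k.+1 (u - a) = G k u.
  by rewrite /G -[k.+1%:R]natr1; congr expR; ring.
elim: n => [|n IH].
  by rewrite /S !big_nil !expr0; ring.
rewrite /S !big_nat_recr//= -/(S n u) -/(S n (u + a)) -/(S n (u - a)).
rewrite Gp Gm.
transitivity (2 * S n u + e * (S n (u + a) + S n (u - a))
  + (- e) ^+ n * n.+1%:R * (2 * G n.+1 u + e * (G n.+2 u + G n u))); first by ring.
rewrite IH exprS -[n.+2%:R]natr1 -[n.+1%:R]natr1.
by ring: e2.
Qed.

(** At the origin both translates of the even function [phi] equal [phi a], so both shift the index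
    the same way and the coefficient is, up to sign, 2 k - 2 (k - 1) = 2. *)
Let S_diag n : 2 * S n 0 + e * (S n a + S n a)
  = \sum_(0 <= i < n) 2 * (- e) ^+ i * G i.+1 0 - 2 * (- e) ^+ n * n%:R * G n.+1 0.
Proof.
have Gp k : G k a = G k.+1 0.
  by rewrite /G -[k.+1%:R]natr1; congr expR; ring.
elim: n => [|n IH].
  by rewrite /S !big_nil; ring.
rewrite /S !big_nat_recr//= -/(S n 0) -/(S n a) Gp.
transitivity (2 * S n 0 + e * (S n a + S n a)
  + (- e) ^+ n * n.+1%:R * (2 * G n.+1 0 + e * (G n.+2 0 + G n.+2 0))); first by ring.
rewrite IH exprS -[n.+1%:R]natr1.
by ring: e2.
Qed.

Let phi (t : R) := limn (S ^~ `|t|).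

Let cphi t : S n `|t| @[n --> \oo] --> phi t.
Proof. exact: cvgS. Qed.

Let pdf_phi : pdf phi.
Proof.
have : (e == 1) || (e == -1) by rewrite -sqrf_eq1 e2.
move=> /orP[/eqP ee|/eqP ee].
- apply: (pdf_alternating a0 mu0) => t.
  rewrite (_ : (fun n => _) = S ^~ `|t|); first exact: cphi.
  by apply/funext => n; rewrite /S ee.
- apply: (pdf_positive a0 mu0) => t.
  rewrite (_ : (fun n => _) = S ^~ `|t|); first exact: cphi.
  by apply/funext => n; apply: eq_bigr => i _; rewrite ee opprK expr1n mul1r.
Qed.

Lemma gaussian_interpolation_kernel : exists H : R -> R, [/\ pdf H,
  forall t, a <= `|t| -> H t = e * expR (- (mu * t ^+ 2)) &
  \sum_(0 <= i < n) 2 * (- e) ^+ i * expR (- (mu * (a * i.+1%:R) ^+ 2))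
    @[n --> \oo] --> H 0].
Proof.
exists (fun t => 2 * phi t + e * (phi (t + a) + phi (t - a))); split.
- exact: pdf_second_difference.
- move=> t at_; set u := `|t|.
  (* [phi] is even, so [t] may be replaced by its absolute value; then u - a >= 0 and [phi (u - a)]
     is the limit of [S n (u - a)]. *)
  have -> : phi (t + a) + phi (t - a) = phi (u + a) + phi (u - a).
    rewrite /u; case: (ger0P t) => [//|t0].
    have ph x : phi (- x) = phi x by rewrite /phi normrN.
    have -> : - t + a = - (t - a) by ring.
    have -> : - t - a = - (t + a) by ring.
    by rewrite !ph addrC.
  have ua : 0 <= u - a by rewrite subr_ge0.
  have u0 : 0 <= u by exact: normr_ge0.
  have c1 : 2 * S n u + e * (S n (u + a) + S n (u - a)) @[n --> \oo]
      --> 2 * phi t + e * (phi (u + a) + phi (u - a)).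
    apply: cvgD; first by apply: cvgMl_tmp; exact: cphi.
    apply: cvgMl_tmp; apply: cvgD.
      by have := @cphi (u + a); rewrite ger0_norm// addr_ge0// ltW.
    by have := @cphi (u - a); rewrite ger0_norm.
  have c2 : 2 * S n u + e * (S n (u + a) + S n (u - a)) @[n --> \oo] --> e * G 0 u + 0.
    under eq_fun do rewrite S_shift.
    apply: cvgD; first exact: cvg_cst.
    have Gm k : G k.+1 (u - a) = G k u.
      by rewrite /G -[k.+1%:R]natr1; congr expR; ring.
    have b1 : (- e) ^+ n * (n.+1%:R * G n u) @[n --> \oo] --> 0.
      apply: (cvg_boundary ua) => n.
      by rewrite Gm lexx andbT mulr_ge0// expR_ge0.
    have b2 : (- e) ^+ n * (n%:R * G n.+1 u) @[n --> \oo] --> 0.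
      apply: (cvg_boundary u0) => n.
      by rewrite mulr_ge0 ?expR_ge0//= ler_wpM2r ?expR_ge0// ler_nat.
    rewrite [X in _ --> X](_ : _ = - e * 0 - 0); last by rewrite mulr0 subr0.
    under eq_fun do rewrite mulrBr mulrCA.
    by apply: cvgB => //; apply: cvgMl_tmp.
  rewrite -(cvg_lim _ c1)// (cvg_lim _ c2)// addr0 /G mulr0 add0r.
  by rewrite real_normK// num_real.
- have c0 : 2 * S n 0 + e * (S n a + S n a) @[n --> \oo]
      --> 2 * phi 0 + e * (phi (0 + a) + phi (0 - a)).
    have ca : S n a @[n --> \oo] --> phi a.
      by have := @cphi a; rewrite gtr0_norm.
    have phN x : phi (- x) = phi x by rewrite /phi normrN.
    rewrite add0r sub0r phN.
    apply: cvgD; apply: cvgMl_tmp; last by apply: cvgD.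
    by have := @cphi 0; rewrite normr0.
  have cb : (- e) ^+ n * (n%:R * G n.+1 0) @[n --> \oo] --> 0.
    apply: (cvg_boundary (lexx 0)) => n.
    by rewrite mulr_ge0 ?expR_ge0//= ler_wpM2r ?expR_ge0// ler_nat.
  rewrite (_ : (fun n => _) = fun n => 2 * S n 0 + e * (S n a + S n a)
      + 2 * ((- e) ^+ n * (n%:R * G n.+1 0))); last first.
    apply/funext => n; rewrite S_diag.
    under eq_bigr do rewrite -[_ * _%:R]addr0.
    by rewrite -/(G _ 0); ring.
  rewrite -[X in _ --> X]addr0 -[X in _ --> _ + X](mulr0 2).
  by apply: cvgD => //; apply: cvgMl_tmp.
Qed.

End FixedParameters.
End OneDimensionalKernels.

(** * Product kernels in several variables and the Gaussian inequalities *)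

Section ProductKernels.
Context {R : realType}.

Section Products.
Variables (T : Type) (I : eqType) (g f e : I -> T -> T -> R).
Hypotheses (sg : forall i, schur (g i)) (sf : forall i, schur (f i)).
Hypothesis (se : forall i, schur (e i)).

Let m i x y := g i x y + f i x y.

Let sm i : schur (m i). Proof. exact: schurD. Qed.

Lemma schur_prod (k : I -> T -> T -> R) (r : seq I) :
  (forall i, schur (k i)) -> schur (fun x y => \prod_(i <- r) k i x y).
Proof.
move=> sk; elim: r => [|i r IH].
  by apply: eq_schur (@schur1 _ T) => x y; rewrite big_nil.
by apply: eq_schur (schurM (sk i) IH) => x y; rewrite big_cons.
Qed.

(** Peeling off one factor, with P and Q the products of [m] and [g] over the rest: m_i P - g_i Q =
    g_i (P - Q) + f_i P. *)
Lemma schur_prod_sub r :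
  schur (fun x y => \prod_(i <- r) m i x y - \prod_(i <- r) g i x y).
Proof.
elim: r => [|i r IH].
  apply: eq_schur (schurZ (lexx 0) (@schur1 _ T)) => x y.
  by rewrite !big_nil subrr mul0r.
apply: eq_schur (schurD (schurM (sg i) IH) (schurM (sf i) (schur_prod r sm))) => x y.
by rewrite !big_cons /m; ring.
Qed.

(* With [m = g + f] above and [g - e] below [g] on the Fourier side, this is
   [prod g - (sum_j (g_j - e_j) prod_(i <> j) m_i - (d - 1) prod m)]. *)
Lemma schur_prod_minorant r : uniq r ->
  schur (fun x y => \sum_(j <- r) (e j x y + f j x y) * \prod_(i <- r | i != j) m i x y
    - (\prod_(i <- r) m i x y - \prod_(i <- r) g i x y)).
Proof.
elim: r => [|i r IH] /=.
  move=> _; apply: eq_schur (schurZ (lexx 0) (@schur1 _ T)) => x y.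
  by rewrite !big_nil !subrr mul0r.
move=> /andP[ir /IH{}IH].
(* One more index multiplies the kernel by m_i and adds e_i prod m + f_i (prod m - prod g), with
   products over [r]. *)
apply: eq_schur (schurD (schurM (sm i) IH) (schurD (schurM (se i) (schur_prod r sm))
  (schurM (sf i) (schur_prod_sub r)))) => x y.
rewrite !big_cons eqxx /=.
have -> : \prod_(k <- r | k != i) m k x y = \prod_(k <- r) m k x y.
  rewrite big_seq_cond [RHS]big_seq; apply: eq_bigl => k.
  by case: (boolP (k \in r)) => //= kr; apply: contraNneq ir => <-.
have -> : \sum_(j <- r) (e j x y + f j x y) * \prod_(k <- i :: r | k != j) m k x y
  = m i x y * \sum_(j <- r) (e j x y + f j x y) * \prod_(k <- r | k != j) m k x y.
  rewrite mulr_sumr big_seq [RHS]big_seq; apply: eq_bigr => j jr.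
  rewrite big_cons; have -> : i != j by apply: contraNneq ir => ->.
  by rewrite mulrCA.
by rewrite /m; ring.
Qed.

End Products.

(** The form of [k] with weights [u] is the right-hand side minus the left-hand side. *)
Lemma psd_offdiag_le (T : eqType) (k g : T -> T -> R) (c : R) (u : T -> R) (r : seq T) :
  uniq r -> psd k -> (forall x, k x x = c) ->
  (forall x y, x != y -> k x y = - g x y) ->
  \sum_(x <- r) \sum_(y <- r | x != y) u x * u y * g x y <= c * \sum_(x <- r) u x ^+ 2.
Proof.
move=> ur k0 kc kg; rewrite -subr_ge0.
have := k0 [seq (u x, x) | x <- r]; congr (_ <= _).
rewrite /qform big_map mulr_sumr -sumrB big_seq [RHS]big_seq.
apply: eq_bigr => x xr; rewrite big_map (bigD1_seq x)//= kc.
congr (_ + _); first by rewrite expr2 mulrC.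
rewrite -sumrN; apply: eq_big => [y|y]; first by rewrite eq_sym.
by rewrite eq_sym => /kg ->; rewrite mulrN.
Qed.

Section GaussianForms.
Local Open Scope classical_set_scope.
Variables (d : nat) (a : 'rV[R]_d) (mu : R).
Hypotheses (a_gt0 : forall j, 0 < a 0 j) (mu0 : 0 < mu).

Definition gaussd (v : 'rV[R]_d) : R := expR (- (mu * \sum_j v 0 j ^+ 2)).

Lemma gaussdE v : gaussd v = \prod_j expR (- (mu * v 0 j ^+ 2)).
Proof. by rewrite /gaussd -expR_sum mulr_sumr sumrN. Qed.

(** [m j] and [o j] are the sums of exp(-mu (a_j k)^2) over all integers k and over the odd ones.
    They arise as m_j = M_j(0) and 2 o_j = M_j(0) - L_j(0), so the two constants are the values at 0
    of the positive definite product kernels. *)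
Lemma gaussian_forms : exists m o : 'I_d -> R, [/\
  forall j, 1 + \sum_(0 <= i < n) 2 * expR (- (mu * (a 0 j * i.+1%:R) ^+ 2))
    @[n --> \oo] --> m j,
  forall j, \sum_(0 <= i < n) (1 + (-1) ^+ i) * expR (- (mu * (a 0 j * i.+1%:R) ^+ 2))
    @[n --> \oo] --> o j &
  forall (T : eqType) (xi : T -> 'rV[R]_d) (u : T -> R) (r : seq T), uniq r ->
    (forall x y, x != y -> exists j, a 0 j <= `|(xi x - xi y) 0 j|) ->
    let Q := \sum_(x <- r) \sum_(y <- r | x != y) u x * u y * gaussd (xi x - xi y) in
    let W := \sum_(x <- r) u x ^+ 2 in
    Q <= (\prod_j m j - 1) * W /\
    - Q <= (2 * \sum_j o j * \prod_(i | i != j) m i - (\prod_j m j - 1)) * W].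
Proof.
have mN1 : (-1 : R) ^+ 2 = 1 by rewrite sqrrN expr1n.
have [f fP] := choice (fun j => gaussian_interpolation_kernel (a_gt0 j) mu0 mN1).
have [e eP] := choice (fun j => gaussian_interpolation_kernel (a_gt0 j) mu0 (expr1n R 2)).
pose g t := expR (- (mu * t ^+ 2)).
have g0 : g 0 = 1 by rewrite /g expr0n mulr0 oppr0 expR0.
exists (fun j => 1 + f j 0), (fun j => 2^-1 * (f j 0 + e j 0)); split.
- move=> j; apply: cvgD; first exact: cvg_cst.
  have [_ _] := fP j; rewrite opprK.
  by under eq_fun do under eq_bigr do rewrite expr1n mulr1.
- move=> j; have [_ _ fj] := fP j; have [_ _ ej] := eP j.
  rewrite [X in X @ _ --> _](_ : _ = fun n => 2^-1 *
     (\sum_(0 <= i < n) 2 * (- -1) ^+ i * expR (- (mu * (a 0 j * i.+1%:R) ^+ 2))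
      + \sum_(0 <= i < n) 2 * (-1) ^+ i * expR (- (mu * (a 0 j * i.+1%:R) ^+ 2)))).
    by apply: cvgMl_tmp; exact: cvgD fj ej.
  apply/funext => n; rewrite -big_split mulr_sumr; apply: eq_bigr => i _ /=.
  by rewrite opprK expr1n; field.
move=> T xi u r ur sep Q W.
pose kk (h : 'I_d -> R -> R) j (x y : T) := h j (xi x 0 j - xi y 0 j).
have sk h j : pdf (h j) -> schur (kk h j) by move=> ph; exact: ph.
have sg j : schur (kk (fun=> g) j) by apply: sk; exact: (pdf_gauss (ltW mu0)).
have sf j : schur (kk f j) by apply: sk; have [] := fP j.
have se j : schur (kk e j) by apply: sk; have [] := eP j.
have kk0 h j x : kk h j x x = h j 0 by rewrite /kk subrr.
have gd x y : \prod_(j <- index_enum 'I_d) kk (fun=> g) j x y = gaussd (xi x - xi y).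
  by rewrite gaussdE; apply: eq_bigr => j _; rewrite /kk /g !mxE.
(* In a coordinate where the points are at least a_j apart, both M_j and L_j vanish; e_j + f_j is
   M_j - L_j. *)
have zero x y : x != y -> exists2 j,
    kk (fun=> g) j x y + kk f j x y = 0 & kk e j x y + kk f j x y = 0.
  move=> /sep[j]; rewrite !mxE => hj; have [_ fh _] := fP j; have [_ eh _] := eP j.
  by exists j; rewrite /kk (fh _ hj) ?(eh _ hj) mulN1r ?mul1r subrr.
have prodM0 x y : x != y ->
    \prod_(i <- index_enum 'I_d) (kk (fun=> g) i x y + kk f i x y) = 0.
  by move=> /zero[j j0 _]; rewrite (bigD1 j)//= j0 mul0r.
split.
- apply: (psd_offdiag_le u ur (schur_psd (schur_prod_sub sg sf (index_enum _)))).
    move=> x; congr (_ - _); first by apply: eq_bigr => j _; rewrite !kk0 g0.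
    by rewrite big1// => j _; rewrite kk0.
  by move=> x y xy; rewrite prodM0// gd sub0r.
- have -> : - Q = \sum_(x <- r) \sum_(y <- r | x != y) u x * u y * - gaussd (xi x - xi y).
    rewrite -sumrN; apply: eq_bigr => x _; rewrite -sumrN.
    by apply: eq_bigr => y _; rewrite mulrN.
  have se' := schur_prod_minorant sg sf se (index_enum_uniq _).
  apply: (psd_offdiag_le u ur (schur_psd se')).
    move=> x; congr (_ - _).
      rewrite mulr_sumr; apply: eq_bigr => j _; rewrite !kk0 mulrA.
      congr (_ * _); first by field.
      by apply: eq_bigr => i _; rewrite !kk0 g0.
    congr (_ - _); first by apply: eq_bigr => j _; rewrite !kk0 g0.
    by rewrite big1// => j _; rewrite kk0.
  (* With [i] a coordinate of separation, the summand j = i vanishes by its first factor and every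
     other summand by the factor M_i in its product. *)
  move=> x y xy; rewrite prodM0// gd sub0r !opprK big1 ?add0r// => j _.
  have [i Mi Ei] := zero _ _ xy.
  have [<-|ij] := eqVneq i j; first by rewrite Ei mul0r.
  by rewrite (bigD1 i)//= Mi mul0r mulr0.
Qed.

End GaussianForms.
End ProductKernels.

(** * From exponentials to negative powers by integration *)

Section PowerSubordination.
Context {R : realType}.
Local Open Scope classical_set_scope.
Variable p : R.
Hypothesis p_gt0 : 0 < p.

Let mu := @lebesgue_measure R.
Let D : set R := `]0, +oo[.
Let mD : measurable D. Proof. by rewrite /D. Qed.
Let q := p^-1.
Let q_gt0 : 0 < q. Proof. by rewrite invr_gt0. Qed.

(* Substituting t = x^q, I (ex y) is p * int_0^oo t^(p-1) e^(-t y) dt without the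
   singular weight. *)
Let ex (y x : R) : R := expR (- (y * x `^ q)).
Let I (f : R -> R) : \bar R := (\int[mu]_(x in D) (f x)%:E)%E.

Let measurable_ex y (A : set R) : measurable_fun A (ex y).
Proof.
apply: measurable_funTS; apply: measurableT_comp => //.
apply: measurableT_comp => //; exact: measurable_funM.
Qed.

Let continuous_ex : {within `[0, +oo[, continuous (ex 1)}.
Proof.
apply/continuous_within_itvcyP; split.
  move=> x; rewrite in_itv /= andbT => x0.
  apply: continuous_comp; last exact: continuous_expR.
  apply: continuousN; apply: continuousM; first exact: cst_continuous.
  apply: differentiable_continuous; apply/derivable1_diffP.
  by apply: derivable_powR; rewrite in_itv /= x0.
rewrite /ex powR0 ?gt_eqF//; apply: continuous_cvg; first exact: continuous_expR.
by apply: cvgN; apply: cvgMl_tmp; exact: powR_cvg0.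
Qed.

(** The substitution of y^p x for x turns x^q into y x^q, because p q = 1. *)
Let I_scale y : 0 < y -> I (ex 1) = ((y `^ p)%:E * I (ex y))%E.
Proof.
move=> y0; set c := y `^ p; have c0 : 0 < c by rewrite powR_gt0.
rewrite /I integral_itv_obnd_cbnd; last first.
  by apply/measurable_EFinP; exact: measurable_ex.
have dF : (fun x => c * x)^`() = cst c.
  by apply/funext => x; rewrite derive1E deriveM// derive_id derive_cst scaler0 addr0 scaler1.
have := @increasing_ge0_integration_by_substitutiony R (fun x => c * x) (ex 1) 0.
rewrite mulr0 => ->.
- rewrite dF integral_itv_obnd_cbnd; last first.
    by apply/measurable_EFinP; exact: measurable_ex.
  rewrite -ge0_integralZl//.
  + apply: eq_integral => x; rewrite inE /= in_itv /= andbT => x0.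
    rewrite -EFinM mulrC /ex; congr ((_ * expR (- _))%:E).
    rewrite mul1r powRM// ?(ltW c0)// /c -powRrM mulfV ?gt_eqF// powRr1//.
    exact: ltW.
  + by apply/measurable_EFinP; exact: measurable_ex.
  + by move=> x _; rewrite lee_fin; exact: expR_ge0.
  + by rewrite lee_fin ltW.
- by move=> x z _ _; rewrite ltr_pM2l.
- by rewrite dF => x _; exact: cst_continuous.
- by rewrite dF; exact: is_cvg_cst.
- by rewrite dF; exact: is_cvg_cst.
- split; first by move=> x _; exact: derivableM.
  rewrite mulr0; apply: cvg_at_right_filter.
  rewrite -[X in _ --> X](mulr0 c).
  by apply: cvgMl_tmp; exact: cvg_id.
- by apply: gt0_cvgMry => //; exact: cvg_id.
- exact: continuous_ex.
- by move=> x _; exact: expR_ge0.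
Qed.

(** With q k >= 2, exp(-x^q) <= k! / x^2 for x >= 1. The factor 4 bounds (1 + x)^2 on [0, 1] and (1
    + x)^2 / x^2 beyond, giving the majorant K / (1 + x)^2 with an explicit primitive. *)
Let I_lty : (I (ex 1) < +oo)%E.
Proof.
pose k := (Num.trunc (2 / q)).+1.
have k2 : 2 <= q * k%:R.
  by rewrite mulrC -ler_pdivrMr// ltW// truncnS_gt.
pose K : R := 4 * k`!%:R.
have F1 : 1 <= k`!%:R :> R by rewrite ler1n fact_gt0.
have F0 : 0 < k`!%:R :> R by exact: lt_le_trans F1.
have K0 : 0 < K by rewrite mulr_gt0.
have bnd x : 0 <= x -> ex 1 x <= K * ((1 + x) ^+ 2)^-1.
  move=> x0; have x1 : 0 < (1 + x) ^+ 2 by rewrite exprn_gt0// ltr_wpDr.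
  rewrite ler_pdivlMr//; have [x1'|/ltW x1'] := leP x 1.
    apply: (@le_trans _ _ (1 * 4)); last by rewrite mul1r /K ler_peMr.
    apply: ler_pM; rewrite ?expR_ge0 ?(ltW x1)//; last by nra.
    by rewrite -[leRHS]expR0 ler_expR oppr_le0 mul1r powR_ge0.
  have xq0 : 0 < x `^ q by rewrite powR_gt0// (lt_le_trans ltr01).
  have e1 : ex 1 x <= k`!%:R / x ^+ 2.
    rewrite /ex mul1r expRN -[leRHS]invf_div.
    rewrite lef_pV2 ?posrE ?expR_gt0 ?divr_gt0 ?exprn_gt0 ?(lt_le_trans ltr01)//.
    apply: (@le_trans _ _ ((x `^ q) ^+ k / k`!%:R)); last first.
      by apply: le_trans (expR_ge1Dxn (Num.trunc (2 / q)) (ltW xq0)); rewrite lerDr.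
    rewrite ler_pM2r ?invr_gt0// -powR_mulrn ?powR_ge0// -powRrM -powR_mulrn//.
    exact: ler_powR.
  apply: le_trans (ler_wpM2r (ltW x1) e1) _.
  rewrite mulrAC ler_pdivrMr ?exprn_gt0 ?(lt_le_trans ltr01)// /K mulrAC.
  rewrite [leRHS]mulrC ler_pM2l//; by nra.
have dV (x : R) : 0 <= x -> is_derive x 1 (fun y : R => (1 + y)^-1) (- ((1 + x) ^+ 2)^-1).
  move=> x0; apply: is_derive_eq
    (is_deriveV _ (is_deriveD (is_derive_cst (1 : R) x 1) (is_derive_id x 1))) _.
    by rewrite gt_eqF// ltr_wpDr.
  by rewrite /GRing.scale /= add0r mulr1.
have cV (x : R) : 0 <= x -> (1 + y)^-1 @[y --> x] --> (1 + x)^-1.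
  move=> x0; have [/derivable1_diffP/differentiable_continuous h _] := dV x x0.
  exact: h.
have cf : {within `[0, +oo[, continuous (fun x : R => K * ((1 + x) ^+ 2)^-1)}.
  rewrite (_ : (fun x => _) = fun x => K * ((1 + x)^-1 * (1 + x)^-1)); last first.
    by apply/funext => x; rewrite -exprVn expr2.
  apply: continuous_in_subspaceT => x; rewrite inE /= in_itv /= andbT => x0.
  by apply: cvgMl_tmp; apply: cvgM; exact: cV.
have leI : (I (ex 1) <= \int[mu]_(x in `[0%R, +oo[) (K * ((1 + x) ^+ 2)^-1)%:E)%E.
  rewrite /I integral_itv_obnd_cbnd; last first.
    by apply/measurable_EFinP; exact: measurable_ex.
  apply: ge0_le_integral => //=.
  - by move=> x _; rewrite lee_fin; exact: expR_ge0.
  - by apply/measurable_EFinP; exact: measurable_ex.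
  - by apply/measurable_EFinP; apply: subspace_continuous_measurable_fun.
  - by move=> x; rewrite in_itv /= andbT => x0; rewrite lee_fin bnd.
apply: (le_lt_trans leI).
have cF (x : R) : 0 <= x ->
    is_derive x 1 (fun y : R => - (K * (1 + y)^-1)) (K * ((1 + x) ^+ 2)^-1).
  move=> x0; apply: is_derive_eq (is_deriveN (is_deriveZ K (dV x x0))) _.
  by rewrite /GRing.scale /= mulrN opprK.
rewrite (@ge0_continuous_FTC2y R _ (fun x => - (K * (1 + x)^-1)) 0 0).
- by rewrite -EFinB ltry.
- by move=> x x0; rewrite mulr_ge0 ?(ltW K0)// invr_ge0 sqr_ge0.
- exact: cf.
- rewrite -[X in _ --> X]oppr0 -[X in _ --> - X](mulr0 K).
  apply: cvgN; apply: cvgMl_tmp; apply/gtr0_cvgV0; last exact: cvg_addrl.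
  by near=> x; rewrite ltr_wpDr.
- by move=> x x0; have [] := cF x (ltW x0).
- apply: cvg_at_right_filter; apply: cvgN; apply: cvgMl_tmp; exact: cV.
- move=> x; rewrite in_itv /= andbT => x0; rewrite derive1E.
  by have [_ ] := cF x (ltW x0).
Unshelve. all: end_near. Qed.

Let I_gt0 : (0 < I (ex 1))%E.
Proof.
apply: (@lt_le_trans _ _ (\int[mu]_(x in `]0%R, 1%R]) (expR (-1))%:E)%E).
  rewrite integral_cst//= /mu lebesgue_measure_itv /= lte_fin ltr01.
  by rewrite -EFinB -EFinM lte_fin subr0 mulr1 expR_gt0.
apply: (@le_trans _ _ (\int[mu]_(x in `]0%R, 1%R]) (ex 1 x)%:E)%E).
  apply: ge0_le_integral => //=; try exact: mD.
  - by apply/measurable_EFinP; exact: measurable_ex.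
  - move=> x; rewrite in_itv /= => /andP[x0 x1]; rewrite lee_fin ler_expR lerN2 mul1r.
    have : x `^ q <= 1 `^ q by rewrite ge0_ler_powR ?nnegrE ?(ltW q_gt0) ?(ltW x0).
    by rewrite powR1.
apply: ge0_subset_integral => //=; try exact: mD.
- by apply/measurable_EFinP; exact: measurable_ex.
- by move=> x _; rewrite lee_fin; exact: expR_ge0.
- by apply: subset_itvl; rewrite bnd_simp.
Qed.

(** A pair (c, y) encodes both c exp(-y t) and the multiple c y^(-p) of a fixed constant to which it
    integrates, so one list serves before and after integration. *)
Definition expsum (s : seq (R * R)) (t : R) := \sum_(x <- s) x.1 * expR (- (x.2 * t)).
Definition powsum (s : seq (R * R)) := \sum_(x <- s) x.1 * x.2 `^ (- p).

Let C := fine (I (ex 1)).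
Let C_gt0 : 0 < C. Proof. by rewrite fine_gt0// I_gt0 I_lty. Qed.

Let I_ex y : 0 < y -> I (ex y) = (C * y `^ (- p))%:E.
Proof.
move=> y0; have CE : I (ex 1) = C%:E by rewrite fineK// ge0_fin_numE ?I_lty// ltW// I_gt0.
have yp : 0 < y `^ p by rewrite powR_gt0.
rewrite mulrC EFinM -CE (I_scale y0) muleA -EFinM powRN mulVf ?mul1e//.
by rewrite gt_eqF.
Qed.

Definition pos_terms (s : seq (R * R)) := forall x, x \in s -> 0 <= x.1 /\ 0 < x.2.

Let expsum_ge0 s t : pos_terms s -> 0 <= expsum s t.
Proof.
move=> s0; rewrite /expsum big_seq; apply: sumr_ge0 => x /s0[x1 _].
by rewrite mulr_ge0 ?expR_ge0.
Qed.

Let measurable_expsum s (A : set R) : measurable_fun A (fun x => expsum s (x `^ q)).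
Proof.
rewrite /expsum; elim: s => [|u s IH].
  by under eq_fun do rewrite big_nil; exact: measurable_cst.
under eq_fun do rewrite big_cons.
by apply: measurable_funD => //; apply: measurable_funM => //; exact: measurable_ex.
Qed.

Let I_expsum s : pos_terms s -> I (fun x => expsum s (x `^ q)) = (C * powsum s)%:E.
Proof.
rewrite /I /expsum /powsum; elim: s => [|u s IH] s0.
  by under eq_integral do rewrite big_nil; rewrite big_nil mulr0 integral0.
have [u1 u2] : 0 <= u.1 /\ 0 < u.2 by apply: s0; rewrite mem_head.
have s0' : pos_terms s by move=> x xs; apply: s0; rewrite in_cons xs orbT.
under eq_integral do rewrite big_cons EFinD EFinM.
rewrite ge0_integralD//=; try exact: mD.
- rewrite IH// big_cons mulrDr EFinD; congr (_ + _)%E.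
  rewrite ge0_integralZl//; try exact: mD.
  + by rewrite -/(I (ex u.2)) I_ex// -EFinM mulrCA.
  + by apply/measurable_EFinP; exact: measurable_ex.
- by move=> x _; rewrite -EFinM lee_fin; apply: mulr_ge0 => //; exact: expR_ge0.
- apply: measurable_funeM; apply/measurable_EFinP; exact: measurable_ex.
- by move=> x _; rewrite lee_fin; exact: (@expsum_ge0 s).
- by apply/measurable_EFinP; exact: (@measurable_expsum s).
Qed.

(** Put t = x^q and integrate. The negative terms of [L] are first moved to the other side, so that
    all integrands are nonnegative and monotone convergence applies; all integrals of finite sums
    being finite, these terms can be moved back afterwards. *)
Lemma expsum_le_powsum_le (L : seq (R * R)) (Rn : nat -> seq (R * R)) (S : R) :
  (forall x, x \in L -> 0 < x.2) ->
  (forall n, pos_terms (Rn n)) ->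
  (forall t, 0 < t -> nondecreasing_seq (fun n => expsum (Rn n) t)) ->
  (forall t, 0 < t -> exists2 l,
     expsum (Rn n) t @[n --> \oo] --> l & expsum L t <= l) ->
  (forall n, powsum (Rn n) <= S) -> powsum L <= S.
Proof.
move=> L0 R0 ndR limR RS.
pose Lp := [seq x <- L | 0 <= x.1].
pose Ln := [seq (- x.1, x.2) | x <- L & ~~ (0 <= x.1)].
have split_sum (h : R -> R) :
    \sum_(x <- L) x.1 * h x.2 + \sum_(x <- Ln) x.1 * h x.2 = \sum_(x <- Lp) x.1 * h x.2.
  rewrite /Ln /Lp big_map !big_filter (bigID (fun x => 0 <= x.1))/=.
  by rewrite -addrA -big_split /= [X in _ + X]big1 ?addr0// => x _; rewrite mulNr subrr.
have eLp t : expsum Lp t = expsum L t + expsum Ln t.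
  by exact: esym (split_sum (fun y => expR (- (y * t)))).
have pLp : powsum Lp = powsum L + powsum Ln.
  by exact: esym (split_sum (fun y => y `^ (- p))).
have Lp0 : pos_terms Lp by move=> x; rewrite mem_filter => /andP[x0 /L0].
have Ln0 : pos_terms Ln.
  move=> _ /mapP[x + ->]; rewrite mem_filter -ltNge => /andP[/ltW x0 /L0].
  by rewrite /= oppr_ge0.
have LR0 n : pos_terms (Ln ++ Rn n).
  by move=> x; rewrite mem_cat => /orP[/Ln0|/R0].
have cat_exp n t : expsum (Ln ++ Rn n) t = expsum Ln t + expsum (Rn n) t.
  by rewrite /expsum big_cat.
have ndLR t : 0 < t -> nondecreasing_seq (fun n => expsum (Ln ++ Rn n) t).
  by move=> t0 m n mn; rewrite !cat_exp lerD2l ndR.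
have xq0 x : D x -> 0 < x `^ q.
  by rewrite /D /= in_itv /= andbT => x0; rewrite powR_gt0.
have : (I (fun x => expsum Lp (x `^ q)) <= (C * (powsum Ln + S))%:E)%E.
  apply: (@le_trans _ _ (\int[mu]_(x in D)
      limn (fun n => (expsum (Ln ++ Rn n) (x `^ q))%:E))%E).
    apply: ge0_le_integral => //=; try exact: mD.
    - by move=> x _; rewrite lee_fin expsum_ge0.
    - by apply/measurable_EFinP; exact: measurable_expsum.
    - apply: (@emeasurable_fun_cvg _ _ _ _ (fun n x => (expsum (Ln ++ Rn n) (x `^ q))%:E)).
        by move=> n; apply/measurable_EFinP; exact: measurable_expsum.
      move=> x Dx; apply: ereal_nondecreasing_is_cvgn => m n mn.
      by rewrite lee_fin ndLR ?xq0.
    - move=> x Dx; have [l cl Ll] := limR _ (xq0 _ Dx).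
      rewrite (_ : limn _ = (expsum Ln (x `^ q) + l)%:E).
        rewrite lee_fin eLp addrC lerD2l.
        exact: Ll.
      apply/cvg_lim => //; apply: cvg_EFin; first exact: nearW.
      rewrite (_ : _ \o _ = fun n => expsum Ln (x `^ q) + expsum (Rn n) (x `^ q)).
        by apply: cvgD => //; exact: cvg_cst.
      by apply/funext => n /=; rewrite cat_exp.
  rewrite monotone_convergence//=; try exact: mD.
  - apply: lime_le.
      apply: ereal_nondecreasing_is_cvgn => m n mn; apply: ge0_le_integral => //=; try exact: mD.
      + by move=> x _; rewrite lee_fin expsum_ge0.
      + by apply/measurable_EFinP; exact: measurable_expsum.
      + by apply/measurable_EFinP; exact: measurable_expsum.
      + by move=> x Dx; rewrite lee_fin ndLR ?xq0.
    apply: nearW => n; rewrite -/(I (fun x => expsum (Ln ++ Rn n) (x `^ q))) I_expsum//.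
    by rewrite lee_fin ler_pM2l// /powsum big_cat /= lerD2l RS.
  - by move=> n; apply/measurable_EFinP; exact: measurable_expsum.
  - by move=> n x _; rewrite lee_fin expsum_ge0.
  - by move=> x Dx m n mn; rewrite lee_fin ndLR ?xq0.
by rewrite I_expsum// lee_fin ler_pM2l// pLp addrC lerD2l.
Qed.

End PowerSubordination.

(** * Lattice sums as limits of sums over boxes *)

Section LatticeBoxes.
Context {R : realType} {d : nat}.
Local Open Scope classical_set_scope.
Implicit Types (N M : nat) (n : 'rV[int]_d).

(** Coding points by finite functions is what lets a product of one-dimensional sums be expanded
    into a sum over the box. *)
Definition box_point N (f : {ffun 'I_d -> 'I_N.*2.+1}) : 'rV[int]_d :=
  \row_j ((f j)%:Z - N%:Z).

Definition box N : seq 'rV[int]_d := [seq box_point f | f <- index_enum {ffun 'I_d -> 'I_N.*2.+1}].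

Definition pbox N : seq 'rV[int]_d := [seq n <- box N | n != 0].

Lemma box_point_inj N : injective (@box_point N).
Proof.
move=> f g /rowP fg; apply/ffunP => j; apply/val_inj.
by have := fg j; rewrite !mxE => /addIr [].
Qed.

Lemma box_uniq N : uniq (box N).
Proof. by rewrite map_inj_uniq ?index_enum_uniq//; exact: box_point_inj. Qed.

Lemma pbox_uniq N : uniq (pbox N). Proof. exact: filter_uniq (box_uniq N). Qed.

Lemma mem_box N n : (n \in box N) = [forall j : 'I_d, (`|n 0%R j| <= N)%N].
Proof.
apply/mapP/forallP => [[f _ ->] j|nN].
  rewrite mxE; have := ltn_ord (f j); move: (nat_of_ord (f j)) => k; lia.
have lt (j : 'I_d) : (absz (n 0 j + N%:Z)%R < N.*2.+1)%N by have := nN j; lia.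
exists [ffun j => Ordinal (lt j)]; first exact: mem_index_enum.
by apply/rowP => j; rewrite mxE ffunE /=; have := nN j; lia.
Qed.

Lemma mem_pbox N n : (n \in pbox N) = (n != 0) && [forall j : 'I_d, (`|n 0%R j| <= N)%N].
Proof. by rewrite mem_filter mem_box. Qed.

Lemma pbox_sub M N : (M <= N)%N -> {subset pbox M <= pbox N}.
Proof.
move=> MN n; rewrite !mem_pbox => /andP[-> /forallP nM]; apply/forallP => j.
exact: leq_trans (nM j) MN.
Qed.

Lemma sub_pbox (s : seq 'rV[int]_d) : {in s, forall n, n != 0} ->
  exists N, {subset s <= pbox N}.
Proof.
elim: s => [|n s IH] s0; first by exists 0%N.
have [N sN] := IH (fun m ms => s0 m (mem_behead (s := n :: s) ms)).
pose M := \max_(j : 'I_d) `|n 0%R j|%N; exists (maxn M N) => m.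
rewrite in_cons => /orP[/eqP ->|/sN]; last by apply: pbox_sub; exact: leq_maxr.
rewrite mem_pbox s0 ?mem_head//; apply/forallP => j.
apply: leq_trans (leq_maxl _ _); exact: (leq_bigmax (F := fun j : 'I_d => `|n 0%R j|%N)).
Qed.

Lemma sum_box_prod (f : 'I_d -> int -> R) N :
  \sum_(n <- box N) \prod_j f j (n 0 j) = \prod_j \sum_(k <- symrange N) f j k.
Proof.
rewrite big_map; under [RHS]eq_bigr => j _.
  rewrite big_map -[iota _ _]/(index_iota 0 N.*2.+1) big_mkord; over.
rewrite bigA_distr_bigA /=; apply: eq_bigr => g _; apply: eq_bigr => j _.
by rewrite mxE.
Qed.

Lemma sum_pbox (f : 'rV[int]_d -> R) N : \sum_(n <- pbox N) f n = \sum_(n <- box N) f n - f 0.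
Proof.
have b0 : 0 \in box N by rewrite mem_box; apply/forallP => j; rewrite mxE.
rewrite big_filter (bigD1_seq (0 : 'rV[int]_d) b0 (box_uniq N))/=.
by rewrite addrAC subrr add0r.
Qed.

Lemma ler_sum_subset (T : eqType) (s t : seq T) (f : T -> R) :
  uniq s -> uniq t -> {subset s <= t} -> (forall x, 0 <= f x) ->
  \sum_(x <- s) f x <= \sum_(x <- t) f x.
Proof.
move=> us ut st f0; rewrite [leRHS](bigID (mem s))/=.
have -> : \sum_(x <- t | x \in s) f x = \sum_(x <- s) f x.
  rewrite -big_filter; apply: perm_big; apply: uniq_perm => //.
    exact: filter_uniq.
  by move=> x; rewrite mem_filter andb_idr// => /st.
by rewrite lerDl sumr_ge0.
Qed.

Lemma nondecreasing_sum_pbox (f : 'rV[int]_d -> R) : (forall n, 0 <= f n) ->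
  nondecreasing_seq (fun N => \sum_(n <- pbox N) f n).
Proof.
move=> f0 M N MN; apply: ler_sum_subset => //; [exact: pbox_uniq..|exact: pbox_sub].
Qed.

(** Every finite set of nonzero lattice points lies in some punctured box, so the supremum over
    boxes is the supremum over all finite sets. *)
Lemma cvg_esum_pbox (f : 'rV[int]_d -> R) B : (forall n, 0 <= f n) ->
  (forall N, \sum_(n <- pbox N) f n <= B) ->
  exists2 l, (\esum_(n in [set n : 'rV[int]_d | n != 0%R]) (f n)%:E = l%:E)%E &
    \sum_(n <- pbox N) f n @[N --> \oo] --> l.
Proof.
move=> f0 fB; set u := fun N => \sum_(n <- pbox N) f n.
have ndu : nondecreasing_seq u by exact: nondecreasing_sum_pbox.
have ubu : has_ubound (range u) by exists B => _ [N _ <-]; exact: fB.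
have cu := nondecreasing_cvgn ndu ubu.
exists (sup (range u)) => //; apply/eqP; rewrite eq_le; apply/andP; split.
  rewrite /esum ge_ereal_sup// => _ [X [finX X0] <-].
  rewrite fsbig_finite//= sumEFin lee_fin.
  have X0' : {in finmap.enum_fset (fset_set X), forall n, n != 0}.
    by move=> n; rewrite in_fset_set// inE => /X0.
  have [N XN] := sub_pbox X0'.
  apply: (@le_trans _ _ (u N)); last by apply: ub_le_sup => //; exists N.
  by apply: ler_sum_subset => //; [exact: finmap.fset_uniq|exact: pbox_uniq].
have ge N : ((u N)%:E <= \esum_(n in [set n : 'rV[int]_d | n != 0%R]) (f n)%:E)%E.
  apply: esum_ge; exists [set` pbox N].
    by split; [exact: finite_seq|move=> n /=; rewrite mem_pbox => /andP[]].
  by rewrite -fsbig_seq ?pbox_uniq// sumEFin.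
move: ge; case: (esum _ _) => [r ger|_|/(_ 0%N)//]; last by rewrite leey.
rewrite lee_fin; apply: ge_sup; first by exists (u 0%N), 0%N.
by move=> _ [N _ <-]; rewrite -lee_fin.
Qed.

(** The bound makes the sums of the positive and of the negative part finite, so [fine] in [latsum]
    returns a genuine difference. *)
Lemma cvg_latsum (f : 'rV[int]_d -> R) B :
  (forall N, \sum_(n <- pbox N) `|f n| <= B) ->
  \sum_(n <- pbox N) f n @[N --> \oo] --> latsum f.
Proof.
move=> fB.
have fpB N : \sum_(n <- pbox N) Num.max (f n) 0 <= B.
  apply: le_trans (fB N); apply: ler_sum => n _.
  by rewrite ge_max ler_norm normr_ge0.
have fnB N : \sum_(n <- pbox N) Num.max (- f n) 0 <= B.
  apply: le_trans (fB N); apply: ler_sum => n _.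
  by rewrite ge_max -normrN ler_norm normr_ge0.
have [|lp ep cp] := cvg_esum_pbox _ fpB; first by move=> n; rewrite le_max lexx orbT.
have [|ln en cn] := cvg_esum_pbox _ fnB; first by move=> n; rewrite le_max lexx orbT.
rewrite /latsum.
have -> : (\esum_(n in [set n : 'rV[int]_d | n != 0%R]) (EFin \o f)^\+ n = lp%:E)%E.
  by rewrite -ep; apply: eq_esum => n _; rewrite funeposE /= -EFin_max.
have -> : (\esum_(n in [set n : 'rV[int]_d | n != 0%R]) (EFin \o f)^\- n = ln%:E)%E.
  by rewrite -en; apply: eq_esum => n _; rewrite funenegE /= -EFin_max.
rewrite -EFinB /=.
rewrite (_ : (fun N => _) = fun N => \sum_(n <- pbox N) Num.max (f n) 0
    - \sum_(n <- pbox N) Num.max (- f n) 0); first exact: cvgB.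
apply/funext => N; rewrite -sumrB; apply: eq_bigr => n _.
have [h|/ltW h] := leP 0 (f n).
  by rewrite max_r ?oppr_le0// subr0.
by rewrite max_l ?oppr_ge0// sub0r opprK.
Qed.

End LatticeBoxes.

(** * Summability of the lattice families and the constants A and B *)

Section LatticeConstants.
Context {R : realType}.
Local Open Scope classical_set_scope.

Definition sqnorm {d : nat} (v : 'rV[R]_d) : R := \sum_j v 0 j ^+ 2.

Lemma sum_symrange (f : int -> R) N : \sum_(k <- symrange N) f k
  = f 0 + \sum_(0 <= i < N) (f i.+1%:Z + f (- i.+1%:Z)).
Proof.
have sE M : \sum_(k <- symrange M) f k = \sum_(0 <= i < M.*2.+1) f (i%:Z - M%:Z).
  by rewrite big_map /index_iota subn0.
rewrite sE; elim: N => [|N IH].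
  by rewrite big_nat1 big_nil subr0 addr0.
rewrite doubleS big_nat_recl// big_nat_recr//= [in RHS]big_nat_recr//= [in RHS]addrA -IH.
have -> : 0%:Z - N.+1%:Z = - N.+1%:Z by lia.
have -> : (N.*2.+2)%:Z - N.+1%:Z = N.+1%:Z by lia.
have -> : \sum_(0 <= i < N.*2.+1) f (i.+1%:Z - N.+1%:Z)
    = \sum_(0 <= i < N.*2.+1) f (i%:Z - N%:Z).
  by apply: eq_bigr => i _; have -> : i.+1%:Z - N.+1%:Z = i%:Z - N%:Z by lia.
by ring.
Qed.

Lemma ler_sum_in (T : eqType) (s : seq T) (f g : T -> R) :
  {in s, forall x, f x <= g x} -> \sum_(x <- s) f x <= \sum_(x <- s) g x.
Proof. by move=> fg; rewrite big_seq [leRHS]big_seq; apply: ler_sum => x /fg. Qed.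

Lemma gt0_powRN_le (x y r : R) : 0 <= r -> 0 < x -> x <= y -> y `^ (- r) <= x `^ (- r).
Proof.
move=> r0 x0 xy; have y0 := lt_le_trans x0 xy.
by rewrite !powRN lef_pV2 ?posrE ?powR_gt0// ge0_ler_powR ?nnegrE ?(ltW x0) ?(ltW y0).
Qed.

(** Comparison with the integral of x^(-1-e), by induction on the sharper bound 1 + (1 - (N +
    1)^(-e)) / e. *)
Lemma sum_powRN_le (e : R) N : 0 < e ->
  \sum_(0 <= i < N) i.+1%:R `^ (- (1 + e)) <= 1 + e^-1.
Proof.
move=> e0.
apply: (@le_trans _ _ (\sum_(0 <= i < N.+1) (i.+1%:R : R) `^ (- (1 + e)))).
  by rewrite big_nat_recr//= lerDl powR_ge0.
apply: (@le_trans _ _ (1 + e^-1 * (1 - N.+1%:R `^ (- e)))); last first.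
  by rewrite lerD2l ler_piMr ?invr_ge0 ?(ltW e0)// gerBl powR_ge0.
elim: N => [|N IH].
  by rewrite big_nat1 powR1 subrr mulr0 addr0.
rewrite big_nat_recr//=; apply: le_trans (lerD IH (lexx _)) _.
rewrite -addrA lerD2l; set x : R := N.+1%:R.
have x0 : 0 < x by rewrite ltr0n.
have -> : N.+2%:R = x + 1 :> R by rewrite natr1.
have x10 : 0 < x + 1 by rewrite addr_gt0.
(* A mean value inequality for x^(-e), obtained from 1/(x + 1) <= ln(x + 1) - ln x and 1 + y <= exp
   y. *)
suff h : e * (x + 1) `^ (- (1 + e)) <= x `^ (- e) - (x + 1) `^ (- e).
  have := ler_wpM2l (_ : 0 <= e^-1) h; rewrite invr_ge0 => /(_ (ltW e0)).
  rewrite mulKf ?gt_eqF// !mulrBr mulr1.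
  move: (e^-1 * _) (e^-1 * _) => A B; lra.
have pE y (r : R) : 0 < y -> y `^ r = expR (r * ln y) by move=> y0; rewrite /powR gt_eqF.
have lnx : (x + 1)^-1 <= ln (x + 1) - ln x.
  have h : -1 < - (x + 1)^-1 by rewrite ltrN2 invf_lt1// ltrDr.
  have := le_ln1Dx h.
  have -> : 1 + - (x + 1)^-1 = x / (x + 1) by field; rewrite gt_eqF.
  by rewrite ln_div// => h1; lra.
rewrite !pE//.
have -> : - (1 + e) * ln (x + 1) = - ln (x + 1) + - e * ln (x + 1) by ring.
have -> : - e * ln x = e * (ln (x + 1) - ln x) + - e * ln (x + 1) by ring.
rewrite !expRD expRN lnK ?posrE//.
set E := expR (- e * _); have E0 : 0 < E by exact: expR_gt0.
have -> : expR (e * (ln (x + 1) - ln x)) * E - E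
  = (expR (e * (ln (x + 1) - ln x)) - 1) * E by ring.
rewrite -/E mulrA ler_pM2r//.
have := expR_ge1Dx (e * (ln (x + 1) - ln x)).
have := ler_wpM2l (ltW e0) lnx.
by lra.
Qed.

Section Constants.
Variables (d : nat) (sigma : R) (a : 'rV[R]_d).
Hypotheses (d_gt0 : (0 < d)%N) (sigma_gt0 : 0 < sigma) (a_gt0 : forall j, 0 < a 0 j).

Let p : R := (d%:R + sigma) / 2.

Let p_gt0 : 0 < p. Proof. by rewrite divr_gt0// ltr_wpDl. Qed.

Lemma enorm_powR (v : 'rV[R]_d) : enorm v `^ (d%:R + sigma) = sqnorm v `^ p.
Proof.
have s0 : 0 <= sqnorm v by apply: sumr_ge0 => j _; exact: sqr_ge0.
rewrite /enorm -powR12_sqrt// -powRrM; congr (_ `^ _).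
by rewrite /p mulrC.
Qed.

Lemma enorm_powRV (v : 'rV[R]_d) : 1 / enorm v `^ (d%:R + sigma) = sqnorm v `^ (- p).
Proof. by rewrite enorm_powR powRN div1r. Qed.

Lemma sqnorm_dilate_gt0 (n : 'rV[int]_d) : n != 0 -> 0 < sqnorm (dilate a n).
Proof.
move=> n0; have [j nj] : exists j, n 0 j != 0.
  apply/existsP; apply: contra_neqT n0 => /existsPn n0.
  by apply/rowP => j; rewrite mxE; apply/eqP/negbNE/n0.
rewrite /sqnorm (bigD1 j)//= ltr_wpDr ?sumr_ge0// => [i _|]; first exact: sqr_ge0.
by rewrite mxE exprn_even_gt0//= mulf_neq0 ?(lt0r_neq0 (a_gt0 j)) ?intr_eq0.
Qed.

(** Writing s for the squared norm, K s dominates max(1, n_j^2) for every j. Splitting the power -p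
    evenly among the d coordinates bounds the sum by a product of one-dimensional sums with exponent
    2 p / d = 1 + sigma / d > 1. *)
Lemma sum_pbox_bounded : exists B, forall N,
  \sum_(n <- pbox N) sqnorm (dilate a n) `^ (- p) <= B.
Proof.
pose K := \sum_j (a 0 j ^+ 2)^-1.
pose r := p / d%:R.
have r0 : 0 <= r by rewrite divr_ge0// ltW.
pose h (k : int) : R := Num.max 1 (k%:~R ^+ 2) `^ (- r).
have K0 : 0 < K.
  rewrite /K (bigD1 (Ordinal d_gt0))//= ltr_wpDr ?invr_gt0 ?exprn_gt0//.
  by apply: sumr_ge0 => j _; rewrite invr_ge0 sqr_ge0.
pose e := sigma / d%:R.
have e0 : 0 < e by rewrite divr_gt0// ltr0n.
have hN N : \sum_(k <- symrange N) h k <= 1 + 2 * (1 + e^-1).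
  rewrite sum_symrange lerD//; first by rewrite /h expr0n max_l// powR1.
  apply: le_trans (ler_wpM2l _ (sum_powRN_le N e0)); last by [].
  rewrite mulr_sumr; apply: ler_sum => i _.
  have hE : h i.+1%:Z = i.+1%:R `^ (- (1 + e)).
    rewrite /h max_r; last by rewrite -pmulrn exprn_ege1// ler1n.
    rewrite -pmulrn -powR_mulrn// -powRrM; congr (_ `^ _).
    by rewrite /r /p /e; field; rewrite pnatr_eq0 -lt0n.
  have -> : h (- i.+1%:Z) = h i.+1%:Z by rewrite /h rmorphN sqrrN.
  by rewrite hE mulr_natl mulr2n.
exists (K `^ p * (1 + 2 * (1 + e^-1)) ^+ d) => N.
have bound n : n != 0 -> sqnorm (dilate a n) `^ (- p) <= K `^ p * \prod_j h (n 0 j).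
  move=> n0; have s0 := sqnorm_dilate_gt0 n0; set s := sqnorm _ in s0 *.
  have ns j : (n 0 j)%:~R ^+ 2 <= K * s.
    have h1 : (a 0 j ^+ 2)^-1 <= K.
      rewrite /K (bigD1 j)//= lerDl sumr_ge0// => i _.
      by rewrite invr_ge0 sqr_ge0.
    have h2 : (a 0 j * (n 0 j)%:~R) ^+ 2 <= s.
      rewrite /s /sqnorm (bigD1 j)//= mxE lerDl sumr_ge0// => i _; exact: sqr_ge0.
    have := ler_pM _ _ h1 h2; rewrite invr_ge0 !sqr_ge0 => /(_ isT isT).
    by rewrite exprMn mulKf// gt_eqF// exprn_gt0.
  have Ks0 : 0 < K * s by rewrite mulr_gt0.
  have Ks1 : 1 <= K * s.
    have [j nj] : exists j, n 0 j != 0.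
      apply/existsP; apply: contra_neqT n0 => /existsPn n0.
      by apply/rowP => j; rewrite mxE; apply/eqP/negbNE/n0.
    apply: le_trans (ns j); rewrite -rmorphXn /= -[1]/(1%:~R) ler_int.
    by rewrite -gtz0_ge1 exprn_even_gt0//.
  have -> : s `^ (- p) = K `^ p * ((K * s) `^ (- r)) ^+ d.
    rewrite -powR_mulrn ?powR_ge0// -powRrM.
    have -> : - r * d%:R = - p by rewrite /r; field; rewrite pnatr_eq0 -lt0n.
    rewrite powRM ?(ltW K0) ?(ltW s0)// mulrA -powRD ?subrr ?powRr0 ?mul1r//.
    by rewrite (lt0r_neq0 K0) implybT.
  rewrite ler_wpM2l ?powR_ge0// -[X in _ ^+ X](card_ord d) -prodr_const.
  apply: ler_prod => j _; rewrite powR_ge0 /=.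
  apply: gt0_powRN_le => //; last by rewrite ge_max Ks1 ns.
apply: (@le_trans _ _ (\sum_(n <- box N) K `^ p * \prod_j h (n 0 j))).
  apply: (@le_trans _ _ (\sum_(n <- pbox N) K `^ p * \prod_j h (n 0 j))).
    apply: ler_sum_in => n.
    by rewrite mem_pbox => /andP[n0 _]; exact: bound.
  apply: ler_sum_subset; [exact: pbox_uniq|exact: box_uniq| |].
    by move=> n; rewrite mem_filter => /andP[].
  by move=> n; rewrite mulr_ge0 ?powR_ge0// prodr_ge0// => j _; exact: powR_ge0.
rewrite -mulr_sumr (sum_box_prod (fun=> h)) ler_wpM2l ?powR_ge0//.
rewrite -[X in _ ^+ X](card_ord d) -prodr_const.
apply: ler_prod => j _; rewrite hN andbT.
by apply: sumr_ge0 => k _; exact: powR_ge0.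
Qed.

Lemma norm_signz (k : int) : `|(-1) ^ k| = 1 :> R.
Proof. by case: k => m; rewrite ?NegzE ?exprnN ?normfV normrX normrN1 expr1n ?invr1. Qed.

Lemma cvg_constB :
  \sum_(n <- pbox N) sqnorm (dilate a n) `^ (- p) @[N --> \oo] --> constB a sigma.
Proof.
have [B BP] := sum_pbox_bounded; rewrite /constB.
have -> : (fun n => 1 / enorm (dilate a n) `^ (d%:R + sigma))
    = fun n => sqnorm (dilate a n) `^ (- p).
  by apply/funext => n; exact: enorm_powRV.
apply: (@cvg_latsum _ _ _ B) => N; apply: le_trans (BP N).
by apply: ler_sum => n _; rewrite ger0_norm// powR_ge0.
Qed.

(** Adding B turns the factor d - 1 into d, so that the coefficients become sums of 1 - (-1)^(n_j).
    These are nonnegative, which makes the box sums monotone. *)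
Lemma cvg_constA :
  \sum_(n <- pbox N) (\sum_j (1 - (-1) ^ (n 0 j))) * sqnorm (dilate a n) `^ (- p)
    @[N --> \oo] --> constA a sigma + constB a sigma.
Proof.
have [B BP] := sum_pbox_bounded.
pose l j := latsum (fun n : 'rV[int]_d => (-1) ^ (n 0 j) / enorm (dilate a n) `^ (d%:R + sigma)).
have cl j : \sum_(n <- pbox N) (-1) ^ (n 0 j) * sqnorm (dilate a n) `^ (- p)
    @[N --> \oo] --> l j.
  rewrite /l.
  have -> : (fun n : 'rV[int]_d => (-1) ^ (n 0 j) / enorm (dilate a n) `^ (d%:R + sigma))
      = fun n : 'rV[int]_d => (-1) ^ (n 0 j) * sqnorm (dilate a n) `^ (- p).
    by apply/funext => n; rewrite -enorm_powRV div1r.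
  apply: (@cvg_latsum _ _ _ B) => N; apply: le_trans (BP N).
  apply: ler_sum => n _; rewrite normrM norm_signz mul1r.
  by rewrite ger0_norm// powR_ge0.
have -> : constA a sigma + constB a sigma = \sum_(j <- index_enum 'I_d) (constB a sigma - l j).
  rewrite sumrB sumr_const card_ord /constA -/(constB a sigma) -(mulr_natl (constB _ _)).
  by rewrite /l; ring.
rewrite (_ : (fun N => _) = fun N => \sum_(j <- index_enum 'I_d)
    (\sum_(n <- pbox N) sqnorm (dilate a n) `^ (- p)
     - \sum_(n <- pbox N) (-1) ^ (n 0 j) * sqnorm (dilate a n) `^ (- p))).
  by apply: cvgr_sum => j; apply: cvgB; [exact: cvg_constB|exact: cl].
apply/funext => N; under eq_bigr do rewrite mulr_suml.
rewrite exchange_big; apply: eq_bigr => j _; rewrite -sumrB; apply: eq_bigr => n _.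
by rewrite mulrBl mul1r.
Qed.

End Constants.
End LatticeConstants.

(** * The two-sided inequality for real quadratic forms *)

Section RealInequality.
Context {R : realType}.
Local Open Scope classical_set_scope.

Lemma cvgr_prod (I : Type) (s : seq I) (f : nat -> I -> R) (l : I -> R) P :
  (forall i, f n i @[n --> \oo] --> l i) ->
  \prod_(i <- s | P i) f n i @[n --> \oo] --> \prod_(i <- s | P i) l i.
Proof.
move=> fl; elim: s => [|i s IH].
  by rewrite big_nil; under eq_fun do rewrite big_nil; exact: cvg_cst.
rewrite big_cons; under eq_fun do rewrite big_cons.
by case: (P i) => //; apply: cvgM.
Qed.

Variables (d : nat) (sigma : R) (a : 'rV[R]_d).
Hypotheses (d_gt0 : (0 < d)%N) (sigma_gt0 : 0 < sigma) (a_gt0 : forall j, 0 < a 0 j).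

Let p : R := (d%:R + sigma) / 2.
Let p_gt0 : 0 < p. Proof. by rewrite divr_gt0// ltr_wpDl. Qed.

Lemma anorm_ge1 (v : 'rV[R]_d) : 1 <= anorm a v -> exists j, a 0 j <= `|v 0 j|.
Proof.
move=> v1; apply/existsP; apply: contraLR v1 => /existsPn h.
rewrite -ltNge; apply: bigmax_lt => // j _.
by rewrite normrM normfV (gtr0_norm (a_gt0 j)) ltr_pdivrMr// mul1r ltNge.
Qed.

Section LatticeGaussians.
Variables (t : R) (m o : 'I_d -> R).
Hypotheses (t_gt0 : 0 < t)
  (cm : forall j, 1 + \sum_(0 <= i < n) 2 * expR (- (t * (a 0 j * i.+1%:R) ^+ 2))
    @[n --> \oo] --> m j)
  (co : forall j, \sum_(0 <= i < n) (1 + (-1) ^+ i) * expR (- (t * (a 0 j * i.+1%:R) ^+ 2))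
    @[n --> \oo] --> o j).

Let g (j : 'I_d) (k : int) : R := expR (- (t * (a 0 j * k%:~R) ^+ 2)).
Let G (n : 'rV[int]_d) : R := expR (- (sqnorm (dilate a n) * t)).

Let g0 j : g j 0 = 1. Proof. by rewrite /g mulr0 expr0n mulr0 oppr0 expR0. Qed.

Let gN j k : g j (- k) = g j k. Proof. by rewrite /g rmorphN mulrN sqrrN. Qed.

Let GE n : G n = \prod_j g j (n 0 j).
Proof.
rewrite /G -expR_sum mulrC /sqnorm mulr_sumr sumrN; congr (expR (- _)).
by apply: eq_bigr => j _; rewrite mxE.
Qed.

Let G0 : G 0 = 1.
Proof. by rewrite GE big1// => j _; rewrite mxE g0. Qed.

Let cg j : \sum_(k <- symrange N) g j k @[N --> \oo] --> m j.
Proof.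
under eq_fun do rewrite sum_symrange g0.
under eq_fun do under eq_bigr do rewrite gN -mulr2n -mulr_natl.
exact: cm.
Qed.

Lemma cvg_pbox_gauss : \sum_(n <- pbox N) G n @[N --> \oo] --> \prod_j m j - 1.
Proof.
under eq_fun do rewrite sum_pbox G0.
apply: cvgB; last exact: cvg_cst.
rewrite (_ : (fun N => _) = fun N => \prod_j \sum_(k <- symrange N) g j k).
  by apply: cvgr_prod.
apply/funext => N; rewrite -(sum_box_prod g); apply: eq_bigr => n _; exact: GE.
Qed.

(** The weight 1 - (-1)^k is 2 for odd k and 0 for even k: coordinate j contributes twice its sum
    over odd integers, the others their full sums, and the origin nothing. *)
Lemma cvg_pbox_gauss_odd :
  \sum_(n <- pbox N) (\sum_j (1 - (-1) ^ (n 0 j))) * G n @[N --> \oo]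
    --> 2 * \sum_j o j * \prod_(i | i != j) m i.
Proof.
pose h j (k : int) : R := (1 - (-1) ^ k) * g j k.
pose gh j i := if i == j then h j else g i.
have chj j : \sum_(k <- symrange N) h j k @[N --> \oo] --> 2 * o j.
  have -> : (fun N => \sum_(k <- symrange N) h j k) = fun N => 2 *
    \sum_(0 <= i < N) (1 + (-1) ^+ i) * expR (- (t * (a 0 j * i.+1%:R) ^+ 2)).
    apply/funext => N; rewrite sum_symrange /h expr0z subrr mul0r add0r mulr_sumr.
    apply: eq_bigr => i _; rewrite gN /g -pmulrn.
    have -> : (-1) ^ (- i.+1%:Z) = (-1) ^+ i.+1 :> R by rewrite -exprnN -exprVn invrN1.
    by rewrite -exprnP exprS; ring.
  by apply: cvgMl_tmp; exact: co.
rewrite mulr_sumr.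
have -> : (fun N => \sum_(n <- pbox N) (\sum_j (1 - (-1) ^ (n 0 j))) * G n)
  = fun N => \sum_(j <- index_enum 'I_d) ((\sum_(k <- symrange N) h j k)
      * \prod_(i | i != j) \sum_(k <- symrange N) g i k).
  apply/funext => N; rewrite sum_pbox [X in _ - X](_ : _ = 0); last first.
    by rewrite big1 ?mul0r// => j _; rewrite mxE expr0z subrr.
  rewrite subr0; under eq_bigr do rewrite mulr_suml.
  rewrite exchange_big; apply: eq_bigr => j _.
  have -> : (\sum_(k <- symrange N) h j k) * \prod_(i | i != j) \sum_(k <- symrange N) g i k
      = \prod_i \sum_(k <- symrange N) gh j i k.
    rewrite [RHS](bigD1 j)//=; congr (_ * _); first by rewrite /gh eqxx.
    by apply: eq_bigr => i /negbTE ij; rewrite /gh ij.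
  rewrite -(sum_box_prod (gh j)); apply: eq_bigr => n _.
  rewrite GE (bigD1 j)//= mulrA [RHS](bigD1 j)//=; congr (_ * _).
    by rewrite /gh eqxx.
  by apply: eq_bigr => i /negbTE ij; rewrite /gh ij.
apply: cvgr_sum => j; rewrite mulrA; apply: cvgM; first exact: chj.
by apply: cvgr_prod.
Qed.

End LatticeGaussians.

Variables (xi : int -> 'rV[R]_d) (r : seq int) (u v : int -> R).
Hypotheses (xi_sep : a_separated a xi) (ur : uniq r).

(** The real part of w_n times the conjugate of w_m, where w = u + i v. *)
Let c n m := u n * u m + v n * v m.
Let dist n m := sqnorm (xi n - xi m).
Let W := \sum_(n <- r) (u n ^+ 2 + v n ^+ 2).

Definition real_form : R :=
  \sum_(n <- r) \sum_(m <- r | n != m) c n m * dist n m `^ (- p).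

Let pairs := [seq (n, m) | n <- r, m <- [seq m <- r | n != m]].

Let sum_pairs (f : int -> int -> R) :
  \sum_(q <- pairs) f q.1 q.2 = \sum_(n <- r) \sum_(m <- r | n != m) f n m.
Proof.
rewrite /pairs big_allpairs_dep; apply: eq_bigr => n _.
by rewrite big_filter.
Qed.

Let sep n m : n != m -> exists j, a 0 j <= `|(xi n - xi m) 0 j|.
Proof. by move=> /eqP nm; apply: anorm_ge1; exact: xi_sep. Qed.

Let dist_gt0 n m : n != m -> 0 < dist n m.
Proof.
move=> /sep[j hj]; rewrite /dist /sqnorm (bigD1 j)//=.
rewrite ltr_wpDr ?sumr_ge0// => [i _|]; first exact: sqr_ge0.
by rewrite exprn_even_gt0//= -normr_gt0 (lt_le_trans (a_gt0 j)).
Qed.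

Let W_ge0 : 0 <= W.
Proof. by apply: sumr_ge0 => n _; rewrite addr_ge0 ?sqr_ge0. Qed.

(** The sign [s] is 1 for the upper bound and -1 for the lower one. *)
Let L s := [seq (s * c q.1 q.2, dist q.1 q.2) | q <- pairs].
Let RB N := [seq (W, sqnorm (dilate a n)) | n <- pbox N].
Let RA N := [seq (W * \sum_j (1 - (-1) ^ ((n : 'rV[int]_d) 0 j)), sqnorm (dilate a n))
  | n <- pbox N].

Let L_gt0 s x : x \in L s -> 0 < x.2.
Proof.
case/mapP => -[n m] /allpairsPdep[n' [m' [_ +]]] [-> ->] ->.
by rewrite mem_filter => /andP[/dist_gt0].
Qed.

Let RB_pos N : pos_terms (RB N).
Proof.
move=> _ /mapP[n nN ->]; split=> //=; apply: sqnorm_dilate_gt0 => //.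
by move: nN; rewrite mem_pbox => /andP[].
Qed.

Let odd_ge0 (n : 'rV[int]_d) : 0 <= \sum_j (1 - (-1) ^ (n 0 j)) :> R.
Proof.
by apply: sumr_ge0 => j _; rewrite subr_ge0 (le_trans (ler_norm _))// norm_signz.
Qed.

Let RA_pos N : pos_terms (RA N).
Proof.
move=> _ /mapP[n nN ->]; split=> /=; first by rewrite mulr_ge0.
by apply: sqnorm_dilate_gt0 => //; move: nN; rewrite mem_pbox => /andP[].
Qed.

Let expsum_RB N t : expsum (RB N) t = W * \sum_(n <- pbox N) expR (- (sqnorm (dilate a n) * t)).
Proof. by rewrite /expsum big_map mulr_sumr. Qed.

Let expsum_RA N t : expsum (RA N) t = W * \sum_(n <- pbox N)
  (\sum_j (1 - (-1) ^ (n 0 j))) * expR (- (sqnorm (dilate a n) * t)).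
Proof. by rewrite /expsum big_map mulr_sumr; apply: eq_bigr => n _; rewrite mulrA. Qed.

Let powsum_RB N : powsum p (RB N) = W * \sum_(n <- pbox N) sqnorm (dilate a n) `^ (- p).
Proof. by rewrite /powsum big_map mulr_sumr. Qed.

Let powsum_RA N : powsum p (RA N) = W * \sum_(n <- pbox N)
  (\sum_j (1 - (-1) ^ (n 0 j))) * sqnorm (dilate a n) `^ (- p).
Proof. by rewrite /powsum big_map mulr_sumr; apply: eq_bigr => n _; rewrite mulrA. Qed.

Let gform (f : int -> R) t :=
  \sum_(x <- r) \sum_(y <- r | x != y) f x * f y * gaussd t (xi x - xi y).

Let expsum_L s t : expsum (L s) t = s * (gform u t + gform v t).
Proof.
rewrite /expsum big_map (sum_pairs (fun n m => s * c n m * expR (- (dist n m * t)))).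
rewrite /gform -big_split mulr_sumr; apply: eq_bigr => n _ /=.
rewrite -big_split mulr_sumr; apply: eq_bigr => m _ /=.
by rewrite /gaussd -/(sqnorm _) [t * _]mulrC -mulrDl mulrA.
Qed.

Let powsum_L s : powsum p (L s) = s * real_form.
Proof.
rewrite /powsum big_map (sum_pairs (fun n m => s * c n m * dist n m `^ (- p))).
rewrite /real_form mulr_sumr; apply: eq_bigr => n _.
by rewrite mulr_sumr; apply: eq_bigr => m _; rewrite mulrA.
Qed.

Let expsum_cat (s1 s2 : seq (R * R)) t : expsum (s1 ++ s2) t = expsum s1 t + expsum s2 t.
Proof. by rewrite /expsum big_cat. Qed.

Let powsum_cat (s1 s2 : seq (R * R)) : powsum p (s1 ++ s2) = powsum p s1 + powsum p s2.
Proof. by rewrite /powsum big_cat. Qed.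

Let nd_RB t : nondecreasing_seq (fun N => expsum (RB N) t).
Proof.
move=> M N MN; rewrite !expsum_RB ler_wpM2l//.
by apply: nondecreasing_sum_pbox MN => n; exact: expR_ge0.
Qed.

Lemma real_form_le : real_form <= constB a sigma * W.
Proof.
have := @expsum_le_powsum_le R p p_gt0 (L 1) RB (constB a sigma * W).
rewrite powsum_L mul1r; apply.
- exact: L_gt0.
- exact: RB_pos.
- by move=> t _; exact: nd_RB.
- move=> t t0; have [m [ o [cm co H]]] := gaussian_forms a_gt0 t0.
  exists (W * (\prod_j m j - 1)).
    rewrite (_ : (fun N => _) = fun N =>
      W * \sum_(n <- pbox N) expR (- (sqnorm (dilate a n) * t))).
      by apply: cvgMl_tmp; exact: (@cvg_pbox_gauss _ _ cm).
    by apply/funext => N; exact: expsum_RB.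
  rewrite expsum_L mul1r mulrC /W big_split mulrDr.
  have [Hu _] := H _ xi u r ur sep; have [Hv _] := H _ xi v r ur sep.
  exact: lerD.
- move=> N; rewrite powsum_RB mulrC ler_wpM2r//.
  have cB := cvg_constB d_gt0 sigma_gt0 a_gt0.
  rewrite -(cvg_lim _ cB)//; apply: nondecreasing_cvgn_le; last first.
    by apply/cvg_ex; eexists; exact: cB.
  by apply: nondecreasing_sum_pbox => n; exact: powR_ge0.
Qed.

(** The Gaussian constant contains - (prod m - 1), the wrong sign for monotone convergence. A finite
    part of that lattice sum, over [pbox M], is put on the left instead; after integration M tends
    to infinity and B cancels. *)
Lemma real_form_ge : - constA a sigma * W <= real_form.
Proof.
have cB := cvg_constB d_gt0 sigma_gt0 a_gt0.
have cA := cvg_constA d_gt0 sigma_gt0 a_gt0.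
have main M : - real_form + W * \sum_(n <- pbox M) sqnorm (dilate a n) `^ (- p)
    <= W * (constA a sigma + constB a sigma).
  have := @expsum_le_powsum_le R p p_gt0 (L (-1) ++ RB M) RA
    (W * (constA a sigma + constB a sigma)).
  rewrite powsum_cat powsum_L powsum_RB mulN1r; apply.
  - by move=> x; rewrite mem_cat => /orP[/L_gt0//|/RB_pos[]].
  - exact: RA_pos.
  - move=> t _ N N' NN'; rewrite !expsum_RA ler_wpM2l//.
    by apply: nondecreasing_sum_pbox NN' => n; rewrite mulr_ge0 ?expR_ge0.
  - move=> t t0; have [m [ o [cm co H]]] := gaussian_forms a_gt0 t0.
    exists (W * (2 * \sum_j o j * \prod_(i | i != j) m i)).
      rewrite (_ : (fun N => _) = fun N => W * \sum_(n <- pbox N)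
          (\sum_j (1 - (-1) ^ (n 0 j))) * expR (- (sqnorm (dilate a n) * t))).
        by apply: cvgMl_tmp; exact: (@cvg_pbox_gauss_odd _ _ _ cm co).
      by apply/funext => N; exact: expsum_RA.
    rewrite expsum_cat expsum_L expsum_RB.
    have cG := @cvg_pbox_gauss _ _ cm.
    have le1 : W * \sum_(n <- pbox M) expR (- (sqnorm (dilate a n) * t)) <= W * (\prod_j m j - 1).
      rewrite ler_wpM2l// -(cvg_lim _ cG)//; apply: nondecreasing_cvgn_le.
        by apply: nondecreasing_sum_pbox => n; exact: expR_ge0.
      by apply/cvg_ex; eexists; exact: cG.
    have [_ Hu] := H _ xi u r ur sep; have [_ Hv] := H _ xi v r ur sep.
    apply: le_trans (lerD (lexx _) le1) _.
    have := lerD Hu Hv; rewrite -/(gform u t) -/(gform v t) -mulrDr -big_split -/W mulrBl.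
    lra.
  - move=> N; rewrite powsum_RA ler_wpM2l//.
    rewrite -(cvg_lim _ cA)//; apply: nondecreasing_cvgn_le; last first.
      by apply/cvg_ex; eexists; exact: cA.
    by apply: nondecreasing_sum_pbox => n; rewrite mulr_ge0 ?powR_ge0.
have lim : - real_form + W * constB a sigma <= W * (constA a sigma + constB a sigma).
  have cv : - real_form + W * \sum_(n <- pbox M) sqnorm (dilate a n) `^ (- p) @[M --> \oo]
      --> - real_form + W * constB a sigma.
    by apply: cvgD; [exact: cvg_cst|apply: cvgMl_tmp; exact: cB].
  by apply: (cvgr_to_le cv); apply: nearW.
by move: lim; rewrite mulrDr lerD2r mulNr [_ * W]mulrC lerNl.
Qed.

End RealInequality.

(** * Sharpness of the constant B *)

Section Sharpness.
Context {R : realType}.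
Local Open Scope classical_set_scope.

Lemma size_box (d N : nat) : size (box N : seq 'rV[int]_d) = (N.*2.+1 ^ d)%N.
Proof.
rewrite size_map -[index_enum _]enumT -cardE card_ffun !card_ord //.
Qed.

Lemma symrange_uniq N : uniq (symrange N).
Proof. by rewrite map_inj_uniq ?iota_uniq// => i j /addIr []. Qed.

Lemma mem_symrange N (k : int) : (`|k| <= N)%N -> k \in symrange N.
Proof.
move=> kN; apply/mapP; exists (absz (k + N%:Z)); last by lia.
by rewrite mem_iota; lia.
Qed.

Variables (d : nat) (sigma : R) (a : 'rV[R]_d).
Hypotheses (d_gt0 : (0 < d)%N) (sigma_gt0 : 0 < sigma) (a_gt0 : forall j, 0 < a 0 j).

Let p : R := (d%:R + sigma) / 2.
Let F (n : 'rV[int]_d) : R := sqnorm (dilate a n) `^ (- p).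
Let F_ge0 n : 0 <= F n. Proof. exact: powR_ge0. Qed.

Lemma dilateB (x y : 'rV[int]_d) : dilate a x - dilate a y = dilate a (x - y).
Proof. by apply/rowP => j; rewrite !mxE rmorphB mulrBr. Qed.

Lemma dilate_separated (nu : int -> 'rV[int]_d) : injective nu ->
  a_separated a (fun k => dilate a (nu k)).
Proof.
move=> inj_nu k l kl; rewrite dilateB; set n := nu k - nu l.
have [j nj] : exists j, n 0 j != 0.
  apply/existsP; apply: contra_notT kl => /existsPn n0; apply: inj_nu.
  apply/eqP; rewrite -subr_eq0; apply/eqP/rowP => j.
  by rewrite [RHS]mxE; apply/eqP/negbNE/n0.
apply: le_trans (le_bigmax _ _ j).
rewrite mxE mulrAC mulfV ?mul1r ?(lt0r_neq0 (a_gt0 j))// -intr_norm.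
by rewrite -[1]/(1%:~R) ler_int -gtz0_ge1 normr_gt0.
Qed.

(** A point x of the box of radius L has all its neighbours x - f, f in [pbox K], inside the box of
    radius K + L; the remaining pairs contribute nonnegative terms. *)
Lemma sum_box_pairs_ge K L :
  (L.*2.+1 ^ d)%:R * \sum_(f <- pbox K) F f
  <= \sum_(x <- box (K + L)) \sum_(y <- box (K + L) | x != y) F (x - y).
Proof.
apply: (@le_trans _ _ (\sum_(x <- (box L : seq 'rV[int]_d)) \sum_(f <- pbox K) F f)).
  by rewrite big_const_seq count_predT iter_addr_0 size_box mulr_natl.
apply: (@le_trans _ _ (\sum_(x <- box L) \sum_(y <- box (K + L) | x != y) F (x - y))).
  apply: ler_sum_in => x xL.
  have -> : \sum_(f <- pbox K) F f = \sum_(y <- [seq x - f | f <- pbox K]) F (x - y).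
    by rewrite big_map; apply: eq_bigr => f _; rewrite opprB addrC subrK.
  rewrite -[leRHS]big_filter; apply: ler_sum_subset => //.
  - by rewrite map_inj_uniq ?pbox_uniq// => f g /addrI /oppr_inj.
  - exact: filter_uniq (box_uniq _).
  move=> _ /mapP[f fK ->]; move: fK; rewrite mem_pbox mem_filter => /andP[f0 /forallP fK].
  rewrite -subr_eq0 opprB addrC subrK f0 /=; rewrite mem_box; apply/forallP => j.
  move: xL; rewrite mem_box => /forallP/(_ j) xL; have := fK j; rewrite !mxE.
  by move: xL; move: (x 0 j) (f 0 j) => A B; lia.
apply: ler_sum_subset; [exact: box_uniq|exact: box_uniq| |by move=> x; exact: sumr_ge0].
move=> x; rewrite !mem_box => /forallP xL; apply/forallP => j.
exact: leq_trans (xL j) (leq_addl _ _).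
Qed.

(** A separated sequence is indexed by all integers, so the indices that do not enumerate the box
    are sent injectively to points outside it. *)
Lemma enumerate_box M : exists nu : int -> 'rV[int]_d, injective nu /\
  [seq nu i%:Z | i <- iota 0 (size (box M : seq 'rV[int]_d))] = box M.
Proof.
set s : seq 'rV[int]_d := box M; set m := size s.
pose far (k : int) : 'rV[int]_d := \row_j (if 0 <= k then k + M.+1%:Z else k - M.+1%:Z).
pose nu (k : int) := if (0 <= k) && (`|k| < m)%N then nth 0 s `|k| else far k.
pose j0 := Ordinal d_gt0.
have farN k : far k \notin s.
  rewrite mem_box; apply/negP => /forallP/(_ j0); rewrite mxE.
  by case: ifP => ?; lia.
have far_inj : injective far.
  move=> k l /rowP/(_ j0); rewrite !mxE.
  by case: ifP => ?; case: ifP => ?; lia.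
exists nu; split.
  move=> k l; rewrite /nu.
  case: ifP => [/andP[k0 km]|_]; case: ifP => [/andP[l0 lm]|_].
  - move/eqP; rewrite nth_uniq ?box_uniq// => /eqP kl; lia.
  - by move=> kl; have := farN l; rewrite -kl mem_nth.
  - by move=> kl; have := farN k; rewrite kl mem_nth.
  - exact: far_inj.
apply: (@eq_from_nth _ 0); first by rewrite size_map size_iota.
move=> i; rewrite size_map size_iota => im.
by rewrite (nth_map 0%N) ?size_iota// nth_iota// add0n /nu /= im.
Qed.

Lemma constB_sharp (C : R) : C < constB a sigma ->
  exists xi (N : nat) (u : int -> R), a_separated a xi /\
    C * \sum_(n <- symrange N) u n ^+ 2 < real_form sigma xi (symrange N) u (fun=> 0).
Proof.
move=> CB; have cB := cvg_constB d_gt0 sigma_gt0 a_gt0.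
have [K CK] : exists K, C < \sum_(n <- pbox K) F n.
  apply/not_existsP => h.
  have : constB a sigma <= C.
    by apply: (cvgr_to_le cB); apply: nearW => K; rewrite leNgt; apply/negP/h.
  by rewrite leNgt CB.
set S := \sum_(n <- pbox K) F n in CK.
(* For fixed K the inner box contains a proportion of the points of the outer box that tends to 1 as
   L grows, while S > C. *)
have [L CL] : exists L, C * ((K + L).*2.+1 ^ d)%:R < S * (L.*2.+1 ^ d)%:R.
  apply/not_existsP => h.
  pose x L : R := L.*2.+1%:R / (K + L).*2.+1%:R.
  have cx : x L @[L --> \oo] --> (1 : R).
    have -> : x = fun L => 1 - K.*2%:R / (K + L).*2.+1%:R.
      apply/funext => L; rewrite /x.
      have -> : L.*2.+1%:R = (K + L).*2.+1%:R - K.*2%:R :> R.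
        by rewrite doubleD -addnS natrD addrC addKr.
      by rewrite mulrBl divff// pnatr_eq0.
    rewrite -[X in _ --> X]subr0; apply: cvgB; first exact: cvg_cst.
    apply: (@squeeze_cvgr _ _ _ _ (cst 0) (fun L => K.*2%:R * L.+1%:R^-1)).
    - near=> L; rewrite divr_ge0//= ler_wpM2l// lef_pV2 ?posrE ?ltr0n// ler_nat.
      lia.
    - exact: cvg_cst.
    - rewrite -[X in _ --> X](mulr0 K.*2%:R); apply: cvgMl_tmp; exact: cvg_harmonic.
  have cxd : S * x L ^+ d @[L --> \oo] --> S * 1 ^+ d.
    have cxk k : x L ^+ k @[L --> \oo] --> (1 : R) ^+ k.
      elim: k => [|k IH]; first by under eq_fun do rewrite expr0; exact: cvg_cst.
      by under eq_fun do rewrite exprS; rewrite exprS; exact: cvgM cx IH.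
    by apply: cvgMl_tmp; exact: (cxk d).
  have : S * 1 ^+ d <= C.
    apply: (cvgr_to_le cxd); apply: nearW => L; have := h L.
    move/negP; rewrite -leNgt => {}h.
    rewrite /x expr_div_n mulrA ler_pdivrMr ?exprn_gt0//.
    by rewrite -!natrX.
  by rewrite expr1n mulr1 leNgt CK.
have [nu [nu_inj nuE]] := enumerate_box (K + L).
set s : seq 'rV[int]_d := box (K + L) in nuE; set m := size s in nuE.
pose r := [seq i%:Z | i <- iota 0 m].
have rN : {subset r <= symrange m}.
  by move=> _ /mapP[i + ->]; rewrite mem_iota => im; apply: mem_symrange; lia.
have ur : uniq r by rewrite map_inj_uniq ?iota_uniq// => i j [].
(* The symmetric window of radius m contains the indices 0, ..., m - 1 of the box points; all its
   other indices get weight 0. *)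
pose u (k : int) : R := (k \in r)%:R.
exists (fun k => dilate a (nu k)), m, u; split; first exact: dilate_separated.
have -> : \sum_(n <- symrange m) u n ^+ 2 = ((K + L).*2.+1 ^ d)%:R.
  rewrite (bigID (mem r))/= [X in _ + X]big1 ?addr0; last first.
    by move=> k kr; rewrite /u (negbTE kr) expr0n.
  have pr : perm_eq [seq k <- symrange m | k \in r] r.
    apply: uniq_perm => // [|k]; first exact: filter_uniq (symrange_uniq _).
    by rewrite mem_filter andb_idr// => /rN.
  rewrite -big_filter (perm_big _ pr)/=.
  rewrite big_seq; under eq_bigr => k kr do rewrite /u kr expr1n.
  rewrite -big_seq big_const_seq count_predT iter_addr_0 size_map size_iota.
  by rewrite /m /s size_box.
apply: (lt_le_trans CL); rewrite mulrC.
apply: le_trans (sum_box_pairs_ge K L) _; rewrite -/s -nuE.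
have rE : [seq nu i%:Z | i <- iota 0 m] = [seq nu k | k <- r].
  by rewrite -map_comp.
rewrite rE big_map.
pose t n k := (u n * u k + 0 * 0) * sqnorm (dilate a (nu n) - dilate a (nu k)) `^ (- p).
have t0 n k : 0 <= t n k.
  by rewrite /t mulr0 addr0 !mulr_ge0 ?powR_ge0.
apply: (@le_trans _ _ (\sum_(n <- r) \sum_(k <- symrange m | n != k) t n k)); last first.
  by apply: ler_sum_subset => // [|n]; [exact: symrange_uniq|exact: sumr_ge0].
apply: ler_sum_in => n nr; rewrite big_map.
rewrite -[leRHS]big_filter -[leLHS]big_filter.
have -> : [seq k <- r | nu n != nu k] = [seq k <- r | n != k].
  by apply: eq_filter => k; rewrite (inj_eq nu_inj).
apply: (@le_trans _ _ (\sum_(k <- [seq k <- r | n != k]) t n k)).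
  apply: ler_sum_in => k; rewrite mem_filter => /andP[_ kr].
  by rewrite /t /u nr kr mulr0 addr0 !mul1r dilateB.
apply: ler_sum_subset => //.
- exact: filter_uniq.
- exact: filter_uniq (symrange_uniq _).
- by move=> k; rewrite !mem_filter => /andP[-> /rN].
Unshelve. all: end_near. Qed.

End Sharpness.

(** * Reduction of the Hermitian form to real forms *)

Section ComplexForms.
Context {R : realType}.
Local Open Scope complex_scope.

Lemma l2sqE N (w : int -> R[i]) :
  l2sq N w = (\sum_(n <- symrange N) (complex.Re (w n) ^+ 2 + complex.Im (w n) ^+ 2))%:C.
Proof. by rewrite /l2sq rmorph_sum; apply: eq_bigr => n _; rewrite /= add_Re2_Im2. Qed.

Lemma sum_antisymmetric_offdiag (r : seq int) (f : int -> int -> R) :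
  (forall n m, f m n = - f n m) -> \sum_(n <- r) \sum_(m <- r | n != m) f n m = 0.
Proof.
move=> fN; set S := LHS; suff : S = - S by lra.
rewrite {1}/S (exchange_big_dep xpredT)//= /S -sumrN; apply: eq_bigr => m _.
rewrite -sumrN; apply: eq_big => n; first by rewrite eq_sym.
by rewrite fN.
Qed.

(** [c] and [e] are the real and imaginary parts of the summand. The imaginary part is antisymmetric
    in n and m because the kernel is symmetric, so its sum vanishes. *)
Lemma hformE (d : nat) (sigma : R) (xi : int -> 'rV[R]_d) N (w : int -> R[i]) :
  hform sigma xi N w = (real_form sigma xi (symrange N)
    (fun n => complex.Re (w n)) (fun n => complex.Im (w n)))%:C.
Proof.
pose K n m := (enorm (xi n - xi m) `^ (d%:R + sigma))^-1.
have K_sym n m : K m n = K n m.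
  rewrite /K /enorm; congr ((Num.sqrt _ `^ _)^-1); apply: eq_bigr => j _.
  by rewrite !mxE -sqrrN opprB.
pose e n m := (complex.Im (w n) * complex.Re (w m)
  - complex.Re (w n) * complex.Im (w m)) * K n m.
pose c n m := (complex.Re (w n) * complex.Re (w m)
  + complex.Im (w n) * complex.Im (w m)) * K n m.
have e0 : \sum_(n <- symrange N) \sum_(m <- symrange N | n != m) e n m = 0.
  by apply: sum_antisymmetric_offdiag => n m; rewrite /e K_sym; ring.
have -> : hform sigma xi N w
   = (\sum_(n <- symrange N) \sum_(m <- symrange N | n != m) c n m)%:C
   + 'i%C * (\sum_(n <- symrange N) \sum_(m <- symrange N | n != m) e n m)%:C.
  rewrite !rmorph_sum mulr_sumr -big_split; apply: eq_bigr => n _ /=.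
  rewrite !rmorph_sum mulr_sumr -big_split; apply: eq_bigr => m _ /=.
  rewrite -fmorphV -/(K n m) /c /e.
  case: (w n) => x1 y1; case: (w m) => x2 y2; simpc.
  by congr (_ +i* _)%C => /=; ring.
rewrite e0 mulr0 addr0; congr (_%:C); apply: eq_bigr => n _; apply: eq_bigr => m _.
by rewrite /c /K enorm_powR powRN.
Qed.

End ComplexForms.

Local Open Scope complex_scope.

Unset Implicit Arguments.

(* The order on R[i] is the partial one: x <= y means that y - x is a
   nonnegative real, so the inequalities include that the form is real. *)
Theorem corollary23 (R : realType) (d : nat) (sigma : R) (a : 'rV[R]_d)
    (d_gt0 : (0 < d)%N) (sigma_gt0 : 0 < sigma)
    (a_gt0 : forall j : 'I_d, 0 < a 0 j) :
  (forall xi : int -> 'rV[R]_d, a_separated a xi ->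
   forall (N : nat) (w : int -> R[i]),
     - (constA a sigma)%:C * l2sq N w <= hform sigma xi N w /\
     hform sigma xi N w <= (constB a sigma)%:C * l2sq N w) /\
  (forall C : R, C < constB a sigma ->
   ~ (forall xi : int -> 'rV[R]_d, a_separated a xi ->
      forall (N : nat) (w : int -> R[i]),
        hform sigma xi N w <= C%:C * l2sq N w)).
Proof.
split=> [xi sep N w|C CB bound].
  rewrite hformE l2sqE -rmorphN -!rmorphM !lecR; split.
    exact: (real_form_ge d_gt0 sigma_gt0 a_gt0 _ _ sep (symrange_uniq N)).
  exact: (real_form_le d_gt0 sigma_gt0 a_gt0 _ _ sep (symrange_uniq N)).
have [xi [N [u [sep lt]]]] := constB_sharp d_gt0 sigma_gt0 a_gt0 CB.
(* Real weights already violate the bound. *)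
have := bound xi sep N (fun n => (u n)%:C); rewrite hformE l2sqE -rmorphM lecR /= leNgt.
under [X in C * X]eq_bigr do rewrite expr0n addr0.
by rewrite lt.
Qed.
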